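(* Define the $q$-series \[ X_2^{(0)}(q)=\sum_{n=0}^\infty\sum_{c=0}^n (q)_n\,q^{c^2+c}\begin{bmatrix} n\\ c\end{bmatrix},\qquad X_2^{(1)}(q)=\sum_{n=1}^\infty\sum_{c=0}^n (q)_{n-1}\,q^{c^2}\begin{bmatrix} n\\ c\end{bmatrix}. \] Then, as formal power series in $t$, \[ X_2^{(0)}(e^{-t})=e^{9t/40}\sum_{n=0}^\infty \frac{T_2^{(0)}(n)}{n!}\Big(\frac{t}{40}\Big)^n,\qquad X_2^{(1)}(e^{-t})=e^{t/40}\sum_{n=0}^\infty \frac{T_2^{(1)}(n)}{n!}\Big(\frac{t}{40}\Big)^n, \] where $T_2^{(a)}(n)=\tfrac12(-1)^{n+1}L(-2n-1,\chi_{20}^{(a)})$ for $a=0,1$.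
   Context: Notation: $(x)_n=(x;q)_n=\prod_{i=1}^n(1-xq^{i-1})$, and $\begin{bmatrix} n\\ c\end{bmatrix}=\frac{(q)_n}{(q)_c(q)_{n-c}}$ for $0\le c\le n$ and $0$ otherwise. The series $X_2^{(a)}$ need not converge for any $q$; after substituting $q=e^{-t}$, the summand indexed by $n$ is $O(t^{n-1})$, so $X_2^{(a)}(e^{-t})$ is a well-defined formal power series in $t$, and the equalities are equalities of formal power series in $t$. The periodic functions $\chi_{20}^{(a)}$ (period $20$) are: $\chi_{20}^{(0)}(n)=1,-1,-1,1$ for $n\equiv 3,7,13,17\pmod{20}$ respectively and $0$ otherwise; $\chi_{20}^{(1)}(n)=1,-1,-1,1$ for $n\equiv1,9,11,19\pmod{20}$ respectively and $0$ otherwise. For a periodic function $\chi$ with mean value zero, $L(s,\chi)=\sum_{n\ge1}\chi(n)n^{-s}$ for $\operatorname{Re}s>1$, analytically continued to an entire function of $s$. *)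

(* Defs.v *)
From HB Require Import structures.
From mathcomp Require Import all_boot all_order all_algebra.
From mathcomp Require Import complex.
From mathcomp Require Import all_classical all_reals all_analysis.

Set Implicit Arguments.
Unset Strict Implicit.
Unset Printing Implicit Defensive.

Import Order.TTheory GRing.Theory Num.Theory numFieldNormedType.Exports.

Local Open Scope classical_set_scope.
Local Open Scope complex_scope.
Local Open Scope ring_scope.

Definition qpoch (A : comNzRingType) (x q : A) (n : nat) : A :=
  \prod_(1 <= i < n.+1) (1 - x * q ^+ i.-1).

(* The indeterminate q is 'X.  The polynomial quotient in qbinom is exact:
   see qbinomK below. *)
Definition qfact (K : fieldType) (n : nat) : {poly K} := qpoch 'X 'X n.

Definition qbinom (K : fieldType) (n c : nat) : {poly K} :=
  if (c <= n)%N then qfact K n %/ (qfact K c * qfact K (n - c)) else 0.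

Lemma qfactS (K : fieldType) (n : nat) :
  qfact K n.+1 = qfact K n * (1 - 'X^(n.+1)).
Proof. by rewrite /qfact /qpoch big_nat_recr //= -exprS. Qed.

Lemma qfact_dvd (K : fieldType) (a b : nat) :
  qfact K a * qfact K b %| qfact K (a + b).
Proof.
have qfact0 : qfact K 0 = 1 by rewrite /qfact /qpoch big_geq.
elim: a b => [|a IHa] b; first by rewrite qfact0 mul1r dvdpp.
elim: b => [|b IHb]; first by rewrite qfact0 mulr1 addn0 dvdpp.
have -> : qfact K (a.+1 + b.+1) = qfact K (a.+1 + b) * (1 - 'X^(b.+1))
    + qfact K (a + b.+1) * (1 - 'X^(a.+1)) * 'X^(b.+1).
  rewrite addnS qfactS addSnnS -mulrA -mulrDr; congr (_ * _).
  rewrite mulrBl mul1r -exprD addrA subrK.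
  by rewrite -[(a + b.+1).+1]addSn.
rewrite dvdp_add //.
  by rewrite [qfact K b.+1]qfactS mulrA dvdp_mul.
by rewrite dvdp_mulr // [qfact K a.+1]qfactS mulrAC dvdp_mul.
Qed.

Lemma qbinomK (K : fieldType) (n c : nat) : (c <= n)%N ->
  qbinom K n c * (qfact K c * qfact K (n - c)) = qfact K n.
Proof.
by move=> cn; rewrite /qbinom cn divpK // -{2}(subnKC cn) qfact_dvd.
Qed.

Definition X20_term (K : fieldType) (n : nat) : {poly K} :=
  \sum_(0 <= c < n.+1) qfact K n * 'X^(c ^ 2 + c) * qbinom K n c.

Definition X21_term (K : fieldType) (n : nat) : {poly K} :=
  \sum_(0 <= c < n.+1) qfact K n.-1 * 'X^(c ^ 2) * qbinom K n c.

(* A formal power series in t is given by its sequence of coefficients. *)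
Definition fps (K : fieldType) := nat -> K.

Definition fps_mul (K : fieldType) (f g : fps K) : fps K :=
  fun N => \sum_(i < N.+1) f i * g (N - i)%N.

(* The series e^(a t). *)
Definition fps_exp (K : fieldType) (a : K) : fps K :=
  fun N => a ^+ N / N`!%:R.

(* P(e^(-t)): each monomial q^k becomes e^(-k t). *)
Definition subst_exp (K : fieldType) (P : {poly K}) : fps K :=
  fun N => \sum_(k < size P) P`_k * fps_exp (- k%:R) N.

(* F is the sum of f n over n >= m0 in the t-adic topology: every coefficient
   of the partial sums is eventually equal to that of F. *)
Definition fps_sum (K : fieldType) (m0 : nat) (f : nat -> fps K) (F : fps K) :
    Prop :=
  forall N : nat, exists M : nat, forall m : nat, (M <= m)%N ->
    \sum_(m0 <= n < m) f n N = F N.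

Definition chi20_0 (n : nat) : int :=
  if (n %% 20)%N \in [:: 3; 17]%N then 1
  else if (n %% 20)%N \in [:: 7; 13]%N then -1 else 0.

Definition chi20_1 (n : nat) : int :=
  if (n %% 20)%N \in [:: 1; 19]%N then 1
  else if (n %% 20)%N \in [:: 9; 11]%N then -1 else 0.

(* R[i] packed as a numClosedFieldType, through which it receives
   the topology of its norm. *)
Definition Cplx (R : realType) : numClosedFieldType := R[i].

Definition cexp (R : realType) (z : Cplx R) : Cplx R :=
  (expR (complex.Re z))%:C *
  (cos (complex.Im z) +i* sin (complex.Im z)).

(* n^(-s), for n >= 1. *)
Definition npow_opp (R : realType) (n : nat) (s : Cplx R) : Cplx R :=
  cexp (- s * (ln n%:R)%:C).

(* Analytic at every point of the plane: a convergent power series expansion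
   represents f near each s0. *)
Definition entire (R : realType) (f : Cplx R -> Cplx R) : Prop :=
  forall s0 : Cplx R, exists a : nat -> Cplx R,
    \forall z \near s0, series (fun k => a k * (z - s0) ^+ k) @ \oo --> f z.

Definition continues_Lseries (R : realType) (chi : nat -> int)
    (L : Cplx R -> Cplx R) : Prop :=
  entire L /\
  forall s : Cplx R, 1 < complex.Re s ->
    \sum_(1 <= n < N) (chi n)%:~R * npow_opp n s @[N --> \oo] --> L s.

(* The entire continuation of the Dirichlet series of chi, which is unique when
   it exists; the zero function otherwise. *)
Definition Lfun (R : realType) (chi : nat -> int) : Cplx R -> Cplx R :=
  xget (fun=> 0) [set L | continues_Lseries chi L].

Definition T2 (R : realType) (chi : nat -> int) (n : nat) : Cplx R :=
  1 / 2 * (-1) ^+ n.+1 * Lfun chi (- 2 * n%:R - 1).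

(* Main.v *)
Require Import Defs.
From HB Require Import structures.
From mathcomp Require Import all_boot all_order all_algebra.
From mathcomp Require Import complex.
From mathcomp Require Import all_classical all_reals all_analysis.
From mathcomp Require Import ring lra zify.
Import Order.TTheory GRing.Theory Num.Theory numFieldNormedType.Exports.
Set Implicit Arguments.
Unset Strict Implicit.
Unset Printing Implicit Defensive.
Local Open Scope classical_set_scope.
Local Open Scope complex_scope.
Local Open Scope ring_scope.

(** The q-series are made into polynomials in a second variable: with
    s_n(y) = sum_c [n,c] q^(c^2) y^c, the truncations
    F_m(x) = sum_(n<m) (x)_(n+1) x^n s_n(q x^2) satisfy, by telescoping,
    F_m(x) + q^4 x^5 F_m(qx) = 1 - q x^2 + (terms divisible by (xq)_m), which is
    the functional equation of sum_n chi(n) x^((n-3)/2) q^((n^2-9)/40).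
    Up to sign, the x-derivative at x = 1 of F_m is the truncated q-series.  The
    second series is treated in the same way with s_(n+1)(x^2) for s_n(q x^2).

    Substituting x = e^(-u), q = e^(-t) and taking a coefficient means pairing a
    polynomial sum f_ab x^a q^b with a polynomial P(a,b) in the exponents, as
    sum f_ab P(a,b).  The map P(a,b) -> P(a+5,b+a+4) dual to q^4 x^5 F(qx) is
    unipotent, so the functional equation determines these pairings: they equal
    sum_i 2^(-i-1) (D^i g(3) - D^i g(7)), where D g(n) = g(n) - g(n+10) and
    g(n) = P((n-3)/2, (n^2-9)/40).

    The L-values are the same expressions.  As chi(n+10) = -chi(n), summation by
    parts turns sum chi(n) n^(-s) into 2^(-k) sum chi(n) D^k n^(-s) plus a finite
    sum; the k-th difference gains k powers of n, so this continues L to all s,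
    and it leaves only the finite sum at negative integers s.  An entire
    continuation is determined on the real axis by the identity theorem. *)

(** * Functions annihilated by iterated differences *)

Section FiniteDegree.
Variables (K : comNzRingType) (T I : Type) (tau : I -> T -> T).

(* For the translations of a lattice these are the polynomial functions of degree < d. *)
Fixpoint deg_lt (d : nat) (f : T -> K) : Prop :=
  if d is d'.+1 then forall i, deg_lt d' (fun x => f x - f (tau i x))
  else f =1 fun=> 0.

Lemma deg_lt_ext d f g : f =1 g -> deg_lt d f -> deg_lt d g.
Proof.
elim: d f g => [|d IH] f g fg /= H; first by move=> x; rewrite -fg.
by move=> i; apply: IH (H i) => x; rewrite !fg.
Qed.

Lemma deg_ltD d f g : deg_lt d f -> deg_lt d g -> deg_lt d (fun x => f x + g x).
Proof.
elim: d f g => [|d IH] f g /= Hf Hg; first by move=> x; rewrite Hf Hg addr0.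
by move=> i; apply: deg_lt_ext (IH _ _ (Hf i) (Hg i)) => x; ring.
Qed.

Lemma deg_ltZ d c f : deg_lt d f -> deg_lt d (fun x => c * f x).
Proof.
elim: d f => [|d IH] f /= Hf; first by move=> x; rewrite Hf mulr0.
by move=> i; apply: deg_lt_ext (IH _ (Hf i)) => x; ring.
Qed.

Lemma deg_ltB d f g : deg_lt d f -> deg_lt d g -> deg_lt d (fun x => f x - g x).
Proof.
move=> Hf /(deg_ltZ (-1)) /(deg_ltD Hf).
by apply: deg_lt_ext => x; ring.
Qed.

Lemma deg_ltS d f : deg_lt d f -> deg_lt d.+1 f.
Proof.
elim: d f => [|d IH] f Hf; first by move=> i x /=; rewrite !Hf subr0.
by move=> i; apply: IH; apply: Hf.
Qed.

Lemma deg_ltW d e f : (d <= e)%N -> deg_lt d f -> deg_lt e f.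
Proof. by move=> /subnK <- Hf; elim: (e - d)%N => [//|n IH]; apply: deg_ltS. Qed.

(** [f] composed with [tau i] is [f] minus its difference, and the latter has lower degree. *)
Lemma deg_lt_comp d i f : deg_lt d f -> deg_lt d (fun x => f (tau i x)).
Proof.
case: d => [|d] Hf; first by move=> x; rewrite Hf.
have := deg_ltB Hf (deg_ltS (Hf i)).
by apply: deg_lt_ext => x; ring.
Qed.

(** Discrete Leibniz rule: f g - f' g' = (f - f') g + f' (g - g'), a prime denoting composition with
    [tau i]; induction on the sum of the degrees. The difference of a factor of degree 0 is zero, so
    d = 0 and e = 0 are split off. *)
Lemma deg_ltM d e f g : deg_lt d.+1 f -> deg_lt e.+1 g ->
  deg_lt (d + e).+1 (fun x => f x * g x).
Proof.
have [n] := ubnP (d + e); elim: n d e f g => // n IH d e f g.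
rewrite ltnS => ltn Hf Hg i.
have H1 : deg_lt (d + e) (fun x => (f x - f (tau i x)) * g x).
  case: d Hf ltn => [|d] Hf ltn.
    apply: (@deg_ltW 0) => // x.
    by have /= -> := Hf i x; rewrite mul0r.
  apply: IH; [lia | exact: Hf | exact: Hg].
have H2 : deg_lt (d + e) (fun x => f (tau i x) * (g x - g (tau i x))).
  case: e Hg ltn {H1} => [|e] Hg ltn.
    apply: (@deg_ltW 0) => // x.
    by have /= -> := Hg i x; rewrite mulr0.
  rewrite addnS; apply: IH; [lia | exact: deg_lt_comp | exact: Hg].
by apply: deg_lt_ext (deg_ltD H1 H2) => x; ring.
Qed.

Lemma deg_lt_cst c : deg_lt 1 (fun=> c).
Proof. by move=> i x /=; rewrite subrr. Qed.

Lemma deg_ltX d n f : deg_lt d.+1 f -> deg_lt (n * d).+1 (fun x => f x ^+ n).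
Proof.
move=> Hf; elim: n => [|n IH].
  exact: deg_lt_cst.
rewrite mulSn; apply: deg_lt_ext (deg_ltM Hf IH) => x.
by rewrite exprS.
Qed.

End FiniteDegree.

(** With this sign, identity plus composition with [tau] equals 2 minus [fdiff]; this produces the
    powers of 1/2 in the recursions below. *)
Definition fdiff (K : zmodType) (T : Type) (tau : T -> T) (f : T -> K) : T -> K :=
  fun x => f x - f (tau x).

Lemma eq_iter_fdiff (K : zmodType) (T : Type) (tau : T -> T) k (f g : T -> K) :
  f =1 g -> iter k (fdiff tau) f =1 iter k (fdiff tau) g.
Proof. by move=> fg; elim: k => [|k IH] x //=; rewrite /fdiff !IH. Qed.

Lemma deg_lt_iter_fdiff (K : comNzRingType) (T : Type) (tau : T -> T) d (f : T -> K) k :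
  deg_lt (fun _ : unit => tau) d f -> (d <= k)%N ->
  iter k (fdiff tau) f =1 fun=> 0.
Proof.
move=> Hf /(deg_ltW)/(_ Hf) {Hf}; elim: k f => [//|k IH] f Hf x.
by rewrite iterSr; apply: IH; apply: Hf tt.
Qed.

(** * Two-variable q-series identities *)

Section StieltjesWigert.
Variables (A : comNzRingType) (q : A) (qb : nat -> nat -> A).
Hypothesis qbn0 : forall n, qb n 0 = 1.
Hypothesis qb_gt : forall n c, (n < c)%N -> qb n c = 0.
Hypothesis qbSl : forall n c, (c <= n)%N ->
  qb n.+1 c.+1 = qb n c.+1 + q ^+ (n - c) * qb n c.
Hypothesis qbSr : forall n c, qb n.+1 c.+1 = q ^+ c.+1 * qb n c.+1 + qb n c.

(** Stieltjes-Wigert polynomials, up to sign and normalisation. The q-binomials enter only through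
    the Pascal rules for [qb], so that they can later be constants of a polynomial ring in x. *)
Definition swpoly n y := \sum_(0 <= c < n.+1) qb n c * q ^+ (c ^ 2) * y ^+ c.

Lemma swpoly_wide n m y : (n < m)%N ->
  swpoly n y = \sum_(0 <= c < m) qb n c * q ^+ (c ^ 2) * y ^+ c.
Proof.
move=> nm; rewrite /swpoly [RHS](big_cat_nat _ (n := n.+1)) //=.
rewrite [X in _ + X]big_nat_cond [X in _ + X]big1 ?addr0 //.
by move=> c /andP[/andP[nc _] _]; rewrite qb_gt // !mul0r.
Qed.

Lemma swpoly0 y : swpoly 0 y = 1.
Proof. by rewrite /swpoly big_nat1 qbn0 !expr0 !mulr1. Qed.

(** First Pascal rule, with (c+1)^2 = c^2 + c + (c+1) and (n-c) + (c+1) = n+1. *)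
Lemma swpolySl n y : swpoly n.+1 y = swpoly n y + y * q ^+ n.+1 * swpoly n (q * y).
Proof.
rewrite [swpoly n y](@swpoly_wide _ n.+2) // /swpoly mulr_sumr.
rewrite !(big_nat_recl n.+1) //= !qbn0 -addrA; congr (_ + _).
rewrite -big_split /=; apply: eq_big_nat => c /andP[_ cn].
rewrite qbSl // exprMn.
have -> : q ^+ n.+1 = q ^+ (n - c) * q ^+ c.+1 by rewrite -exprD; congr (_ ^+ _); lia.
have -> : q ^+ (c.+1 ^ 2) = q ^+ (c ^ 2) * q ^+ c * q ^+ c.+1.
  by rewrite -!exprD; congr (_ ^+ _); lia.
rewrite (exprS y); ring.
Qed.

(** Second Pascal rule, with (c+1)^2 = c^2 + 2c + 1. Equated with the previous recurrence, it gives
    a q-difference equation in y at fixed n. *)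
Lemma swpolySr n y :
  swpoly n.+1 y = swpoly n (q * y) + q * y * swpoly n (q ^+ 2 * y).
Proof.
rewrite [swpoly n (q * y)](@swpoly_wide _ n.+2) // /swpoly mulr_sumr.
rewrite !(big_nat_recl n.+1) //= !qbn0 -addrA; congr (_ + _).
rewrite -big_split /=; apply: eq_big_nat => c /andP[_ cn].
rewrite qbSr //.
have -> : (q ^+ 2 * y) ^+ c = q ^+ (2 * c) * y ^+ c by rewrite exprM -exprMn.
have -> : (q * y) ^+ c.+1 = q ^+ c.+1 * y ^+ c.+1 by rewrite exprMn.
have -> : q ^+ (c.+1 ^ 2) = q ^+ (c ^ 2) * q ^+ (2 * c) * q.
  by rewrite -exprD -exprSr; congr (_ ^+ _); lia.
rewrite !exprS; ring.
Qed.

(** Every product contains the factor 1 - x, so the sum vanishes at x = 1 and only its first-order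
    part there matters. The argument q x^2 supplies the extra q^c of the first series. *)
Definition strange0 m x := \sum_(n < m)
  (\prod_(i < n.+1) (1 - x * q ^+ i)) * x ^+ n * swpoly n (q * x ^+ 2).

Definition strange1 m x := \sum_(n < m)
  (\prod_(i < n.+1) (1 - x * q ^+ i)) * x ^+ n * swpoly n.+1 (x ^+ 2).

Lemma prod_shift x n :
  \prod_(i < n) (1 - q * x * q ^+ i) = \prod_(i < n) (1 - x * q ^+ i.+1).
Proof. by apply: eq_bigr => i _; rewrite exprS; ring. Qed.

Lemma prod_split x n : \prod_(i < n.+1) (1 - x * q ^+ i) =
  (1 - x) * \prod_(i < n) (1 - x * q ^+ i.+1).
Proof. by rewrite big_ord_recl expr0 mulr1. Qed.

Lemma strange0S n x : strange0 n.+1 x = strange0 n x +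
  (\prod_(i < n.+1) (1 - x * q ^+ i)) * x ^+ n * swpoly n (q * x ^+ 2).
Proof. by rewrite /strange0 big_ord_recr. Qed.

(** Induction on m: the new terms of the two sums must match the change of the remainder. All of
    them contain (xq)_m, and the two recurrences for [swpoly] reduce the match to a ring identity in
    two of its values. *)
Lemma strange0_qdiff m x :
  strange0 m x + q ^+ 4 * x ^+ 5 * strange0 m (q * x) = 1 - q * x ^+ 2
    - (\prod_(i < m) (1 - x * q ^+ i.+1)) *
      (x ^+ m * (1 - q ^+ m.+1 * x ^+ 2) * swpoly m (q * x ^+ 2)).
Proof.
elim: m => [|m IH]; first by rewrite /strange0 !big_ord0 swpoly0; ring.
rewrite !strange0S mulrDr addrACA IH.
rewrite prod_split !prod_shift big_ord_recr /=.
set w := \prod_(i < m) _.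
have E1 := swpolySl m (q * x ^+ 2).
have E2 := swpolySr m (q * x ^+ 2).
have -> : q * (q * x) ^+ 2 = q ^+ 2 * (q * x ^+ 2) by ring.
move: (swpoly m.+1 _) (swpoly m (q * x ^+ 2)) (swpoly m (q * (q * x ^+ 2)))
  (swpoly m (q ^+ 2 * (q * x ^+ 2))) E1 E2.
move=> b' b c d -> E2.
(* Both recurrences compute [swpoly] at m+1; eliminating it expresses d through b and c. *)
have {}E2 : q ^+ 2 * x ^+ 2 * d = b + q * x ^+ 2 * q ^+ m.+1 * c - c.
  by rewrite E2; ring.
rewrite exprMn [q ^+ m.+2]exprS [x ^+ m.+1]exprS.
have -> : q ^+ 4 * x ^+ 5 * (w * (1 - x * q ^+ m.+1) * (q ^+ m * x ^+ m) * d)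
  = q ^+ 2 * x ^+ 3 * (w * (1 - x * q ^+ m.+1) * (q ^+ m * x ^+ m)) *
     (q ^+ 2 * x ^+ 2 * d) by ring.
rewrite E2 !exprS; ring.
Qed.

Lemma strange1S n x : strange1 n.+1 x = strange1 n x +
  (\prod_(i < n.+1) (1 - x * q ^+ i)) * x ^+ n * swpoly n.+1 (x ^+ 2).
Proof. by rewrite /strange1 big_ord_recr. Qed.

Lemma strange1_qdiff m x :
  strange1 m x + q ^+ 3 * x ^+ 5 * strange1 m (q * x) = 1 - q ^+ 2 * x ^+ 4
    - (\prod_(i < m) (1 - x * q ^+ i.+1)) *
      (x ^+ m * (1 - q ^+ m.+1 * x ^+ 2) * swpoly m.+1 (x ^+ 2)).
Proof.
elim: m => [|m IH].
  (* The remainder at m = 0 is (1 - q x^2)(1 + q x^2), which cancels 1 - q^2 x^4. *)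
  by rewrite /strange1 !big_ord0 swpolySl !swpoly0 expr1; ring.
rewrite !strange1S mulrDr addrACA IH.
rewrite prod_split !prod_shift big_ord_recr /=.
set w := \prod_(i < m) _.
have E1 := swpolySl m.+1 (x ^+ 2).
have E2 := swpolySr m.+1 (x ^+ 2).
have -> : (q * x) ^+ 2 = q ^+ 2 * x ^+ 2 by ring.
move: (swpoly m.+2 _) (swpoly m.+1 (x ^+ 2)) (swpoly m.+1 (q * x ^+ 2))
  (swpoly m.+1 (q ^+ 2 * x ^+ 2)) E1 E2.
move=> a' a b c -> E2.
have {}E2 : q * x ^+ 2 * c = a + x ^+ 2 * q ^+ m.+2 * b - b by rewrite E2; ring.
rewrite exprMn [x ^+ m.+1]exprS.
have -> : q ^+ 3 * x ^+ 5 * (w * (1 - x * q ^+ m.+1) * (q ^+ m * x ^+ m) * c)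
  = q ^+ 2 * x ^+ 3 * (w * (1 - x * q ^+ m.+1) * (q ^+ m * x ^+ m)) *
     (q * x ^+ 2 * c) by ring.
rewrite E2 !exprS; ring.
Qed.

End StieltjesWigert.

(** * Pascal rules for the q-binomial coefficients *)

Section QBinomial.
Variable K : fieldType.

Lemma qfact0 : qfact K 0 = 1.
Proof. by rewrite /qfact /qpoch big_geq. Qed.

Lemma subr1X_neq0 n : 1 - 'X^(n.+1) != 0 :> {poly K}.
Proof.
apply/eqP => /(congr1 (fun p : {poly K} => p.[0])).
by rewrite !hornerE expr0n subr0 => /eqP; rewrite oner_eq0.
Qed.

Lemma qfact_neq0 n : qfact K n != 0.
Proof.
elim: n => [|n IH]; first by rewrite qfact0 oner_neq0.
by rewrite qfactS mulf_neq0 // subr1X_neq0.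
Qed.

Lemma qbinom_gt n c : (n < c)%N -> qbinom K n c = 0.
Proof. by move=> nc; rewrite /qbinom leqNgt nc. Qed.

Lemma qbinomn0 n : qbinom K n 0 = 1.
Proof.
apply: (mulIf (qfact_neq0 n)); rewrite mul1r.
by have := qbinomK K (leq0n n); rewrite qfact0 mul1r subn0.
Qed.

Lemma qbinomnn n : qbinom K n n = 1.
Proof.
apply: (mulIf (qfact_neq0 n)); rewrite mul1r.
by have := qbinomK K (leqnn n); rewrite subnn qfact0 mulr1.
Qed.

Lemma qbinom_mulSl n c : (c < n)%N ->
  qbinom K n c.+1 * (1 - 'X^(c.+1)) = qbinom K n c * (1 - 'X^(n - c)).
Proof.
move=> cn; apply: (mulIf (mulf_neq0 (qfact_neq0 c) (qfact_neq0 (n - c.+1)))).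
have := qbinomK K cn; have := qbinomK K (ltnW cn).
rewrite qfactS => E1 E2.
have E3 : qfact K (n - c) = qfact K (n - c.+1) * (1 - 'X^(n - c)).
  by rewrite -[in LHS](subnSK cn) qfactS subnSK.
transitivity (qfact K n); first by rewrite -E2; ring.
by rewrite -E1 E3; ring.
Qed.

Lemma qbinom_mulSS n c : (c <= n)%N ->
  qbinom K n.+1 c.+1 * (1 - 'X^(c.+1)) = qbinom K n c * (1 - 'X^(n.+1)).
Proof.
move=> cn; apply: (mulIf (mulf_neq0 (qfact_neq0 c) (qfact_neq0 (n - c)))).
have := qbinomK K cn; have cn' : (c.+1 <= n.+1)%N by [].
have := qbinomK K cn'; rewrite subSS !qfactS => E1 E2.
by rewrite [RHS]mulrAC E2 -E1; ring.
Qed.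

(** After multiplication by 1 - q^(c+1) every term is a multiple of [n,c], and the claim is 1 -
    q^(n+1) = (1 - q^(n-c)) + q^(n-c) (1 - q^(c+1)). *)
Lemma qbinomSl n c : (c <= n)%N ->
  qbinom K n.+1 c.+1 = qbinom K n c.+1 + 'X^(n - c) * qbinom K n c.
Proof.
rewrite leq_eqVlt => /orP[/eqP->|cn].
  by rewrite !qbinomnn qbinom_gt // subnn expr0 mulr1 add0r.
apply: (mulIf (subr1X_neq0 c)).
rewrite (qbinom_mulSS (ltnW cn)) mulrDl (qbinom_mulSl cn).
have -> : 'X^(n.+1) = 'X^(n - c) * 'X^(c.+1) :> {poly K}.
  by rewrite -exprD; congr (_ ^+ _); lia.
ring.
Qed.

(** Same method, with 1 - q^(n+1) = q^(c+1) (1 - q^(n-c)) + (1 - q^(c+1)). *)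
Lemma qbinomSr n c :
  qbinom K n.+1 c.+1 = 'X^(c.+1) * qbinom K n c.+1 + qbinom K n c.
Proof.
case: (ltngtP c n) => [cn|cn|->]; last first.
- by rewrite !qbinomnn qbinom_gt // mulr0 add0r.
- by rewrite !qbinom_gt ?mulr0 ?addr0 // ltnS ltnW.
apply: (mulIf (subr1X_neq0 c)).
rewrite (qbinom_mulSS (ltnW cn)) mulrDl -mulrA (qbinom_mulSl cn).
have -> : 'X^(n.+1) = 'X^(n - c) * 'X^(c.+1) :> {poly K}.
  by rewrite -exprD; congr (_ ^+ _); lia.
ring.
Qed.

End QBinomial.

(** * Pairing polynomials with functions of the exponents *)

Section Pairing.
Variable K : fieldType.

Definition coef_pair (p : {poly K}) (g : nat -> K) : K := \sum_(b < size p) p`_b * g b.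

(** The outer variable is x, with exponent [a]; the inner one is q, with exponent [b]. *)
Definition pairing (F : {poly {poly K}}) (P : nat * nat -> K) : K :=
  \sum_(a < size F) coef_pair F`_a (fun b => P (a : nat, b)).

Lemma sum_coef_wide (B : nzRingType) (V : nmodType) (p : {poly B}) (phi : nat -> B -> V) n :
  (forall i, phi i 0 = 0) -> (size p <= n)%N ->
  \sum_(i < size p) phi i p`_i = \sum_(i < n) phi i p`_i.
Proof.
move=> phi0 pn.
rewrite -!(big_mkord xpredT (fun i => phi i p`_i)) [RHS](big_cat_nat _ (n := size p)) //=.
rewrite [X in _ + X]big_nat_cond [X in _ + X]big1 ?addr0 //.
by move=> i /andP[/andP[pi _] _]; rewrite nth_default.
Qed.

Lemma coef_pair_wide (p : {poly K}) g n : (size p <= n)%N -> coef_pair p g = \sum_(b < n) p`_b * g b.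
Proof. by apply: (sum_coef_wide (phi := fun b c => c * g b)) => b; rewrite mul0r. Qed.

Lemma eq_coef_pair p g h : g =1 h -> coef_pair p g = coef_pair p h.
Proof. by move=> gh; apply: eq_bigr => b _; rewrite gh. Qed.

Lemma coef_pair0 g : coef_pair 0 g = 0.
Proof. by rewrite /coef_pair size_poly0 big_ord0. Qed.

Lemma coef_pairD p r g : coef_pair (p + r) g = coef_pair p g + coef_pair r g.
Proof.
pose n := maxn (size p) (size r).
rewrite !(@coef_pair_wide _ _ n) ?size_polyD ?leq_maxl ?leq_maxr // -big_split.
by apply: eq_bigr => i _; rewrite coefD mulrDl.
Qed.

Lemma coef_pairZr p c g : coef_pair p (fun b => c * g b) = c * coef_pair p g.
Proof. by rewrite /coef_pair mulr_sumr; apply: eq_bigr => i _; rewrite mulrCA. Qed.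

Lemma coef_pairBr p g h : coef_pair p (fun b => g b - h b) = coef_pair p g - coef_pair p h.
Proof. by rewrite /coef_pair -sumrB; apply: eq_bigr => i _; rewrite mulrBr. Qed.

Lemma coef_pairC c g : coef_pair c%:P g = c * g 0%N.
Proof.
rewrite (@coef_pair_wide _ _ 1) ?size_polyC_leq1 //.
by rewrite big_ord1 coefC.
Qed.

Lemma coef_pairMX p g : coef_pair (p * 'X) g = coef_pair p (fun b => g b.+1).
Proof.
rewrite (@coef_pair_wide _ _ (size p).+1); last first.
  by rewrite (leq_trans (size_polyMleq _ _)) // size_polyX addn2.
rewrite big_ord_recl coefMX eqxx mul0r add0r.
by apply: eq_bigr => i _; rewrite coefMX.
Qed.

Lemma eq_pairing F P Q : P =1 Q -> pairing F P = pairing F Q.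
Proof. by move=> PQ; apply: eq_bigr => a _; apply: eq_coef_pair => b. Qed.

Lemma pairing_wide (F : {poly {poly K}}) P n : (size F <= n)%N ->
  pairing F P = \sum_(a < n) coef_pair F`_a (fun b => P (a : nat, b)).
Proof.
by apply: (sum_coef_wide (phi := fun a p => coef_pair p (fun b => P (a, b)))) => a; rewrite coef_pair0.
Qed.

Lemma pairing0 P : pairing 0 P = 0.
Proof. by rewrite /pairing size_poly0 big_ord0. Qed.

Lemma pairingD F G P : pairing (F + G) P = pairing F P + pairing G P.
Proof.
pose n := maxn (size F) (size G).
rewrite !(@pairing_wide _ _ n) ?size_polyD ?leq_maxl ?leq_maxr // -big_split.
by apply: eq_bigr => i _; rewrite coefD coef_pairD.
Qed.

Lemma pairingBr F P Q :
  pairing F (fun ab => P ab - Q ab) = pairing F P - pairing F Q.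
Proof. by rewrite /pairing -sumrB; apply: eq_bigr => a _; rewrite -coef_pairBr. Qed.

Lemma pairingZr F c P : pairing F (fun ab => c * P ab) = c * pairing F P.
Proof. by rewrite /pairing mulr_sumr; apply: eq_bigr => a _; rewrite -coef_pairZr. Qed.

Lemma pairing0r F : pairing F (fun=> 0) = 0.
Proof.
by rewrite -[RHS](mul0r (pairing F (fun=> 0))) -pairingZr; apply: eq_pairing => ab; rewrite mul0r.
Qed.

Lemma pairingN F P : pairing (- F) P = - pairing F P.
Proof.
apply/eqP; rewrite -addr_eq0 -pairingD addNr; apply/eqP; exact: pairing0.
Qed.

Lemma pairingB F G P : pairing (F - G) P = pairing F P - pairing G P.
Proof. by rewrite pairingD pairingN. Qed.

Lemma pairingC p P : pairing p%:P P = coef_pair p (fun b => P (0%N, b)).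
Proof.
rewrite (@pairing_wide _ _ 1) ?size_polyC_leq1 //.
by rewrite big_ord1 coefC.
Qed.

Lemma pairingMX F P : pairing (F * 'X) P = pairing F (fun ab => P (ab.1.+1, ab.2)).
Proof.
rewrite (@pairing_wide _ _ (size F).+1); last first.
  by rewrite (leq_trans (size_polyMleq _ _)) // size_polyX addn2.
rewrite big_ord_recl coefMX eqxx coef_pair0 add0r.
by apply: eq_bigr => i _; rewrite coefMX.
Qed.

Lemma pairingMq F P : pairing (F * 'X%:P) P = pairing F (fun ab => P (ab.1, ab.2.+1)).
Proof.
elim/poly_ind: F P => [|F p IH] P; first by rewrite mul0r !pairing0.
rewrite mulrDl mulrAC !pairingD !pairingMX IH; congr (_ + _).
by rewrite -polyCM !pairingC coef_pairMX.
Qed.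

Lemma pairingMXn F P i j : pairing (F * ('X ^+ i * 'X%:P ^+ j)) P =
  pairing F (fun ab => P (ab.1 + i, ab.2 + j)%N).
Proof.
elim: i P => [|i IH] P.
  rewrite expr0 mul1r; elim: j P => [|j IH] P.
    by rewrite expr0 mulr1; apply: eq_pairing => -[a b]; rewrite !addn0.
  rewrite exprSr mulrA pairingMq IH; apply: eq_pairing => -[a b] /=.
  by rewrite addnS.
rewrite exprSr -mulrA ['X * _]mulrC 2!mulrA pairingMX -mulrA IH.
by apply: eq_pairing => -[a b] /=; rewrite addnS.
Qed.

(** Replacing x by q x turns x^a q^b into x^a q^(b+a). *)
Lemma pairing_qX F P : pairing (F \Po ('X%:P * 'X)) P =
  pairing F (fun ab => P (ab.1, ab.2 + ab.1)%N).
Proof.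
elim/poly_ind: F P => [|F p IH] P; first by rewrite comp_poly0 !pairing0.
rewrite comp_poly_MXaddC !pairingD mulrA !pairingMX pairingMq IH !pairingC /=.
congr (_ + _); last by apply: eq_coef_pair => b; rewrite addn0.
by apply: eq_pairing => -[a b] /=; rewrite addnS.
Qed.

(** Dual to multiplication by x q^j. *)
Definition mono_shift (j : nat) (ab : nat * nat) := (ab.1 + 1, ab.2 + j)%N.

Lemma pairing_1subM F P j : pairing ((1 - 'X * 'X%:P ^+ j) * F) P =
  pairing F (fun ab => P ab - P (mono_shift j ab)).
Proof.
have -> : (1 - 'X * 'X%:P ^+ j) * F = F - F * ('X ^+ 1 * 'X%:P ^+ j).
  by rewrite mulrBl mul1r expr1 [F * _]mulrC.
rewrite pairingB pairingMXn -pairingBr.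
by apply: eq_pairing => -[a b].
Qed.

(** Each factor 1 - x q^(i+1) acts on P as a difference and lowers its degree, so m of them
    annihilate P. This discards the remainders of the truncated functional equations. *)
Lemma pairing_prod_eq0 m F P : deg_lt mono_shift m P ->
  pairing (\prod_(i < m) (1 - 'X * 'X%:P ^+ i.+1) * F) P = 0.
Proof.
elim: m F P => [|m IH] F P HP.
  by rewrite -[RHS](pairing0r (\prod_(i < 0) (1 - 'X * 'X%:P ^+ i.+1) * F)); apply: eq_pairing.
rewrite big_ord_recr /= [_ * (1 - _)]mulrC -mulrA pairing_1subM.
exact: IH (HP m.+1).
Qed.

End Pairing.

(** * The functional equation solved on pairings, and the coefficients of the q-series *)

Section Formal.
Variable K : numFieldType.

Lemma pairing_snd (F : {poly {poly K}}) g : pairing F (fun ab => g ab.2) = coef_pair F.[1] g.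
Proof.
elim/poly_ind: F => [|F p IH]; first by rewrite pairing0 horner0 coef_pair0.
by rewrite pairingD pairingMX pairingC hornerMXaddC mulr1 coef_pairD IH.
Qed.

(* Dual to F(x) -> q^e x^5 F(qx). *)
Definition qshift (e : nat) (ab : nat * nat) := (ab.1 + 5, ab.2 + ab.1 + e)%N.

(** [qshift e] is not a translation, but it carries [mono_shift j] to [mono_shift j.+1], so it
    preserves a degree defined by all these translations together. *)
Lemma deg_lt_mono_qshift e d (P : nat * nat -> K) :
  deg_lt mono_shift d P -> deg_lt mono_shift d (P \o qshift e).
Proof.
elim: d P => [|d IH] P HP /=; first by move=> x; exact: HP.
move=> j; apply: deg_lt_ext (IH _ (HP j.+1)) => -[a b] /=.
by congr (P _ - P _); rewrite /qshift /mono_shift /=; congr pair; lia.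
Qed.

Lemma deg_lt_mono_fdiff e d k (P : nat * nat -> K) :
  deg_lt mono_shift d P -> deg_lt mono_shift d (iter k (fdiff (qshift e)) P).
Proof.
move=> HP; elim: k => [//|k IH] /=.
exact: deg_ltB IH (deg_lt_mono_qshift e IH).
Qed.

(* Euler's transformation of the divergent series sum_j (-1)^j (g(a + 10 j) - g(b + 10 j)),
   exact as soon as g is a polynomial of degree < k. *)
Definition abel_euler (k : nat) (a b : nat) (g : nat -> K) : K :=
  \sum_(i < k) 2^-1 ^+ i.+1 *
    (iter i (fdiff (addn^~ 10)) g a - iter i (fdiff (addn^~ 10)) g b).

(** Writing D for [fdiff (qshift e)], the hypothesis says 2 <F,P> = P(0,0) - P(A,B) + <F,DP>.
    Iterating j times leaves the remainder 2^(-j) <F,D^j P>, which is 0 at j = k. *)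
Lemma pairing_functional_eq (F : {poly {poly K}}) e m A B k (P : nat * nat -> K) :
  (forall P, deg_lt mono_shift m P -> pairing F P + pairing F (P \o qshift e) = P (0, 0)%N - P (A, B)) ->
  deg_lt mono_shift m P -> deg_lt (fun _ : unit => qshift e) k P ->
  pairing F P = \sum_(i < k) 2^-1 ^+ i.+1 *
    (iter i (fdiff (qshift e)) P (0, 0)%N - iter i (fdiff (qshift e)) P (A, B)).
Proof.
move=> HF HP Hk.
suff H j : pairing F P = \sum_(i < j) 2^-1 ^+ i.+1 *
    (iter i (fdiff (qshift e)) P (0, 0)%N - iter i (fdiff (qshift e)) P (A, B)) +
    2^-1 ^+ j * pairing F (iter j (fdiff (qshift e)) P).
  rewrite (H k) (@eq_pairing _ _ _ (fun=> 0)) ?pairing0r ?mulr0 ?addr0 //.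
  exact: deg_lt_iter_fdiff Hk (leqnn k).
elim: j => [|j IH]; first by rewrite big_ord0 add0r expr0 mul1r.
rewrite big_ord_recr /= {1}IH -addrA; congr (_ + _).
have := HF _ (deg_lt_mono_fdiff e j HP).
set Q := iter j _ P; rewrite {1}/fdiff pairingBr => <-.
rewrite exprSr.
have -> : pairing F (fun x => Q (qshift e x)) = pairing F (Q \o qshift e) by [].
by field.
Qed.

(** In the coordinate n = 2a + r, with n^2 = 40b + r^2, the map [qshift e] is n -> n + 10: the first
    relation is clear, and the second amounts to 2e = r + 5. *)
Lemma iter_fdiff_qshift e r (g : nat -> K) (P : nat * nat -> K) i a b n :
  (2 * e = r + 5)%N ->
  (forall a b n, n = (2 * a + r)%N -> (n ^ 2 = 40 * b + r ^ 2)%N -> P (a, b) = g n) ->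
  n = (2 * a + r)%N -> (n ^ 2 = 40 * b + r ^ 2)%N ->
  iter i (fdiff (qshift e)) P (a, b) = iter i (fdiff (addn^~ 10)) g n.
Proof.
move=> er Pg; elim: i a b n => [|i IH] a b n na nb; first exact: Pg.
rewrite /= {1}/fdiff [RHS]/fdiff (IH a b n na nb); congr (_ - _).
by apply: IH => /=; nia.
Qed.

(** The value of (a + r/2) b^N where n = 2a + r and n^2 = 40b + r^2. *)
Definition moment (r N n : nat) : K :=
  n%:R / 2 * ((n%:R ^+ 2 - r%:R ^+ 2) / 40) ^+ N.

(** The weight has degree N+1 for the translations [mono_shift j], but 2N+1 for [qshift e], under
    which b grows quadratically; hence the separate bounds on m and k. The points (0,0) and (A,B)
    correspond to n = r and n = 10 - r. *)
Lemma pairing_moment (F : {poly {poly K}}) e r m A B k N :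
  (forall P, deg_lt mono_shift m P -> pairing F P + pairing F (P \o qshift e) = P (0, 0)%N - P (A, B)) ->
  (2 * e = r + 5)%N -> (2 * A + r = 10 - r)%N -> ((10 - r) ^ 2 = 40 * B + r ^ 2)%N ->
  (N + 2 <= m)%N -> (2 * N + 2 <= k)%N ->
  pairing F (fun ab => (ab.1%:R + r%:R / 2) * ab.2%:R ^+ N) =
  abel_euler k r (10 - r) (moment r N).
Proof.
move=> HF er HA HB Nm Nk; set P := fun ab : nat * nat => _.
have Hm : deg_lt mono_shift m P.
  have H1 : deg_lt mono_shift 2 (fun ab => ab.1%:R + r%:R / 2 : K).
    by move=> j l x /=; rewrite !natrD; ring.
  have H2 : deg_lt mono_shift 2 (fun ab => ab.2%:R : K).
    by move=> j l x /=; rewrite !natrD; ring.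
  apply: deg_ltW (deg_ltM H1 (deg_ltX N H2)); lia.
have Hk : deg_lt (fun _ : unit => qshift e) k P.
  have H1 : deg_lt (fun _ : unit => qshift e) 2 (fun ab => ab.1%:R + r%:R / 2 : K).
    by move=> j l x /=; rewrite !natrD; ring.
  have H2 : deg_lt (fun _ : unit => qshift e) 3 (fun ab => ab.2%:R : K).
    by move=> j l h x /=; rewrite !natrD; ring.
  apply: deg_ltW (deg_ltM H1 (deg_ltX N H2)); lia.
rewrite (pairing_functional_eq HF Hm Hk); apply: eq_bigr => i _.
have Pg : forall a b n, n = (2 * a + r)%N -> (n ^ 2 = 40 * b + r ^ 2)%N -> P (a, b) = moment r N n.
  move=> a b n na nb; rewrite /P /moment /=; congr (_ * _ ^+ _).
    by rewrite na natrD natrM; field.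
  have -> : n%:R ^+ 2 = 40 * b%:R + r%:R ^+ 2 :> K.
    by rewrite -!natrX nb natrD natrM.
  by field.
congr (_ * (_ - _)).
  by apply: (iter_fdiff_qshift _ er Pg); rewrite ?muln0.
by apply: (iter_fdiff_qshift _ er Pg).
Qed.

Let q : {poly {poly K}} := 'X%:P.
Let qb n c : {poly {poly K}} := (qbinom K n c)%:P.

Fact qbn0 n : qb n 0 = 1. Proof. by rewrite /qb qbinomn0. Qed.
Fact qb_gt n c : (n < c)%N -> qb n c = 0.
Proof. by move=> nc; rewrite /qb qbinom_gt. Qed.
Fact qbSl n c : (c <= n)%N -> qb n.+1 c.+1 = qb n c.+1 + q ^+ (n - c) * qb n c.
Proof. by move=> nc; rewrite /qb /q qbinomSl // polyCD polyCM rmorphXn. Qed.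
Fact qbSr n c : qb n.+1 c.+1 = q ^+ c.+1 * qb n c.+1 + qb n c.
Proof. by rewrite /qb /q qbinomSr // polyCD polyCM rmorphXn. Qed.

Lemma pairing_mon i j P : pairing (q ^+ j * 'X ^+ i) P = P (i, j) :> K.
Proof. 
rewrite mulrC -[_ * _]mul1r pairingMXn pairingC coef_pairC mul1r //.
Qed.

Lemma comp_swpoly n y : swpoly q qb n y \Po (q * 'X) = swpoly q qb n (y \Po (q * 'X)).
Proof.
rewrite /swpoly raddf_sum; apply: eq_bigr => c _.
by rewrite /= !comp_polyM !rmorphXn /= !comp_polyC.
Qed.

Lemma comp_factor n : (\prod_(i < n) (1 - 'X * q ^+ i)) \Po (q * 'X) =
  \prod_(i < n) (1 - q * 'X * q ^+ i).
Proof.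
rewrite rmorph_prod; apply: eq_bigr => i _.
by rewrite /= rmorphB rmorph1 /= comp_polyM rmorphXn /= comp_polyX comp_polyC.
Qed.

Lemma comp_strange0 m : strange0 q qb m 'X \Po (q * 'X) = strange0 q qb m (q * 'X).
Proof.
rewrite /strange0 raddf_sum; apply: eq_bigr => n _.
rewrite /= !comp_polyM comp_factor comp_swpoly comp_polyM !rmorphXn /= comp_polyX.
by rewrite comp_polyC.
Qed.

Lemma comp_strange1 m : strange1 q qb m 'X \Po (q * 'X) = strange1 q qb m (q * 'X).
Proof.
rewrite /strange1 raddf_sum; apply: eq_bigr => n _.
by rewrite /= !comp_polyM comp_factor comp_swpoly !rmorphXn /= comp_polyX.
Qed.

Lemma pairing_shift F e P :
  pairing (q ^+ e * 'X ^+ 5 * (F \Po (q * 'X))) P = pairing F (P \o qshift e) :> K.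
Proof.
rewrite mulrC [q ^+ e * _]mulrC pairingMXn pairing_qX.
by apply: eq_pairing => -[a b]; rewrite /= /qshift /= .
Qed.

(** The remainder in [strange0_qdiff] contains (xq)_m and pairs to 0 with P. What is left is 1 - q
    x^2, with exponents (0,0) and (2,1). *)
Lemma pairing_strange0 m P : deg_lt mono_shift m P ->
  pairing (strange0 q qb m 'X) P + pairing (strange0 q qb m 'X) (P \o qshift 4)
    = P (0, 0)%N - P (2, 1)%N :> K.
Proof.
move=> HP; rewrite -pairing_shift comp_strange0 -pairingD.
rewrite (strange0_qdiff qbn0 qb_gt qbSl qbSr) !pairingB (pairing_prod_eq0 _ HP).
by rewrite subr0 -{1}[q]expr1 pairing_mon -[1]mulr1 -{1}(expr0 q) -(expr0 'X) pairing_mon.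
Qed.

Lemma pairing_strange1 m P : deg_lt mono_shift m P ->
  pairing (strange1 q qb m 'X) P + pairing (strange1 q qb m 'X) (P \o qshift 3)
    = P (0, 0)%N - P (4, 2)%N :> K.
Proof.
move=> HP; rewrite -pairing_shift comp_strange1 -pairingD.
rewrite (strange1_qdiff qbn0 qb_gt qbSl qbSr) !pairingB (pairing_prod_eq0 _ HP).
by rewrite subr0 pairing_mon -[1]mulr1 -{1}(expr0 q) -(expr0 'X) pairing_mon.
Qed.

(** The weight drops by b^N when a increases by one, whatever c is; this plays the role of the
    x-derivative at x = 1. The freedom in c allows r/2, which turns a + c into n/2. *)
Lemma pairing_1subX F c N :
  pairing ((1 - 'X) * F) (fun ab => (ab.1%:R + c) * ab.2%:R ^+ N) =
  - coef_pair F.[1] (fun b => b%:R ^+ N : K).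
Proof.
rewrite -[X in 1 - X]mulr1 -(expr0 'X%:P) pairing_1subM -pairing_snd -mulN1r -pairingZr.
apply: eq_pairing => -[a b] /=; rewrite natrD addn0; ring.
Qed.

Lemma subst_exp_pair p N :
  subst_exp p N = (-1) ^+ N / N`!%:R * coef_pair p (fun b => b%:R ^+ N : K).
Proof.
rewrite -coef_pairZr; apply: eq_bigr => k _; rewrite /fps_exp [in LHS]exprNn; congr (_ * _).
exact: mulrAC.
Qed.

Lemma qfact_prod n : qfact K n = \prod_(i < n) (1 - 'X ^+ i.+1).
Proof. by elim: n => [|n IH]; rewrite ?qfact0 ?big_ord0 // qfactS IH big_ord_recr. Qed.

Lemma coef_pair_sum m (p : nat -> {poly K}) g : coef_pair (\sum_(n < m) p n) g = \sum_(n < m) coef_pair (p n) g.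
Proof.
by elim: m => [|m IH]; rewrite ?big_ord0 ?coef_pair0 // !big_ord_recr /= coef_pairD IH.
Qed.

Lemma horner1_factor n : (\prod_(i < n) (1 - 'X * q ^+ i.+1)).[1] = qfact K n.
Proof.
rewrite qfact_prod horner_prod; apply: eq_bigr => i _.
by rewrite hornerD hornerN hornerM hornerX horner_exp !hornerC mul1r.
Qed.

Lemma horner1_swpoly n j : (swpoly q qb n (q ^+ j * 'X ^+ 2)).[1] =
  \sum_(0 <= c < n.+1) 'X^(c ^ 2 + j * c) * qbinom K n c.
Proof.
rewrite /swpoly horner_sum; apply: eq_bigr => c _.
rewrite !hornerM !horner_exp !hornerM !horner_exp hornerX !hornerC.
by rewrite !mulr1 -exprM exprD; ring.
Qed.

(** From m = N+2 on, the functional equation determines the pairing, so the coefficient of t^N no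
    longer depends on m. *)
Lemma sum_X20 m N k : (N + 2 <= m)%N -> (2 * N + 2 <= k)%N ->
  \sum_(0 <= n < m) subst_exp (X20_term K n) N =
  - ((-1) ^+ N / N`!%:R) * abel_euler k 3 7 (moment 3 N).
Proof.
move=> Nm Nk; have := pairing_moment (r := 3) (@pairing_strange0 m) erefl erefl erefl Nm Nk.
rewrite -[(10 - 3)%N]/7%N => <-.
(* The factor i = 0 of each product is 1 - x; the rest of the product becomes (q)_n at x = 1. *)
have -> : strange0 q qb m 'X = (1 - 'X) * \sum_(n < m)
    (\prod_(i < n) (1 - 'X * q ^+ i.+1)) * 'X ^+ n * swpoly q qb n (q ^+ 1 * 'X ^+ 2).
  by rewrite mulr_sumr; apply: eq_bigr => n _; rewrite prod_split expr1 !mulrA.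
rewrite pairing_1subX mulrNN horner_sum.
rewrite (eq_bigr (fun n : 'I_m => X20_term K n)).
  by rewrite coef_pair_sum mulr_sumr big_mkord; apply: eq_bigr => n _; rewrite subst_exp_pair.
move=> n _; rewrite !hornerM horner1_factor horner1_swpoly horner_exp hornerX.
rewrite expr1n mulr1 mulr_sumr; apply: eq_bigr => c _.
by rewrite mul1n mulrA.
Qed.

(** Summand n of [strange1] yields the term of index n+1, whose prefactor is (q)_n; hence the range
    from 1 to m. *)
Lemma sum_X21 m N k : (N + 2 <= m)%N -> (2 * N + 2 <= k)%N ->
  \sum_(1 <= n < m.+1) subst_exp (X21_term K n) N =
  - ((-1) ^+ N / N`!%:R) * abel_euler k 1 9 (moment 1 N).
Proof.
move=> Nm Nk; have := pairing_moment (r := 1) (@pairing_strange1 m) erefl erefl erefl Nm Nk.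
rewrite -[(10 - 1)%N]/9%N => <-.
have -> : strange1 q qb m 'X = (1 - 'X) * \sum_(n < m)
    (\prod_(i < n) (1 - 'X * q ^+ i.+1)) * 'X ^+ n * swpoly q qb n.+1 (q ^+ 0 * 'X ^+ 2).
  by rewrite mulr_sumr; apply: eq_bigr => n _; rewrite prod_split expr0 mul1r !mulrA.
rewrite pairing_1subX mulrNN horner_sum.
rewrite (eq_bigr (fun n : 'I_m => X21_term K n.+1)).
  rewrite (coef_pair_sum _ (fun n => X21_term K n.+1)) mulr_sumr big_add1 big_mkord.
  by apply: eq_bigr => n _; rewrite subst_exp_pair.
move=> n _; rewrite !hornerM horner1_factor horner1_swpoly horner_exp hornerX.
rewrite expr1n mulr1 mulr_sumr; apply: eq_bigr => c _.
by rewrite mul0n addn0 mulrA.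
Qed.

End Formal.

(** * Complex sequences and the exponential series *)

Section ComplexModulus.
Variable R : realType.
Implicit Types z w : Cplx R.
Local Notation Re := complex.Re.
Local Notation Im := complex.Im.

(** The norm of [Cplx R] takes values in [Cplx R] itself; estimates are easier with a modulus in the
    ordered field [R]. *)
Definition cmod z : R := Re `|z|.

Lemma cmodE z : `|z| = (cmod z)%:C :> Cplx R.
Proof. by rewrite /cmod normc_def. Qed.

Lemma cmod_sqrt z : cmod z = Num.sqrt (Re z ^+ 2 + Im z ^+ 2).
Proof. by rewrite /cmod normc_def. Qed.

Lemma cmod_ge0 z : 0 <= cmod z.
Proof. by rewrite cmod_sqrt sqrtr_ge0. Qed.

Lemma cmodD z w : cmod (z + w) <= cmod z + cmod w.
Proof. by rewrite -lecR rmorphD /= -!cmodE ler_normD. Qed.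

Lemma cmodM z w : cmod (z * w) = cmod z * cmod w.
Proof. by apply: (@complexI R); rewrite rmorphM /= -!cmodE normrM. Qed.

Lemma cmodN z : cmod (- z) = cmod z.
Proof. by rewrite /cmod normrN. Qed.

Lemma cmodX z n : cmod (z ^+ n) = cmod z ^+ n.
Proof. by apply: (@complexI R); rewrite rmorphXn /= -!cmodE normrX. Qed.

Lemma cmod_sum (I : Type) (r : seq I) (P : pred I) (F : I -> Cplx R) :
  cmod (\sum_(i <- r | P i) F i) <= \sum_(i <- r | P i) cmod (F i).
Proof.
elim/big_rec2: _ => [|i y x _ yx]; first by rewrite /cmod normr0.
by apply: le_trans (cmodD _ _) _; rewrite lerD2l.
Qed.

Lemma cmod_real (x : R) : cmod x%:C = `|x|.
Proof. by rewrite cmod_sqrt /= expr0n addr0 sqrtr_sqr. Qed.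

Lemma normRe_le z : `|Re z| <= cmod z.
Proof. by rewrite cmod_sqrt -sqrtr_sqr ler_wsqrtr // lerDl sqr_ge0. Qed.

Lemma normIm_le z : `|Im z| <= cmod z.
Proof. by rewrite cmod_sqrt -sqrtr_sqr ler_wsqrtr // lerDr sqr_ge0. Qed.

Lemma cmod_leReIm z : cmod z <= `|Re z| + `|Im z|.
Proof.
rewrite cmod_sqrt -[leRHS]ger0_norm ?addr_ge0 // -[leRHS]sqrtr_sqr ler_wsqrtr //.
rewrite sqrrD !real_normK ?num_real // lerD2r lerDl.
by rewrite mulrn_wge0 // mulr_ge0.
Qed.

Lemma cReD z w : Re (z + w) = Re z + Re w. Proof. by case: z w => [a b] [c d]. Qed.
Lemma cImD z w : Im (z + w) = Im z + Im w. Proof. by case: z w => [a b] [c d]. Qed.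
Lemma cReN z : Re (- z) = - Re z. Proof. by case: z. Qed.
Lemma cImN z : Im (- z) = - Im z. Proof. by case: z. Qed.
Lemma cReM z w : Re (z * w) = Re z * Re w - Im z * Im w.
Proof. by case: z w => [a b] [c d]. Qed.
Lemma cImM z w : Im (z * w) = Re z * Im w + Im z * Re w.
Proof. by case: z w => [a b] [c d]. Qed.

Lemma Re_sum (I : Type) (r : seq I) (P : pred I) (F : I -> Cplx R) :
  Re (\sum_(i <- r | P i) F i) = \sum_(i <- r | P i) Re (F i).
Proof. by elim/big_rec2: _ => // i y x _ <-; rewrite cReD. Qed.

Lemma Im_sum (I : Type) (r : seq I) (P : pred I) (F : I -> Cplx R) :
  Im (\sum_(i <- r | P i) F i) = \sum_(i <- r | P i) Im (F i).
Proof. by elim/big_rec2: _ => // i y x _ <-; rewrite cImD. Qed.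

Lemma cplxP z w : Re z = Re w -> Im z = Im w -> z = w.
Proof. by case: z w => [a b] [c d] /= -> ->. Qed.

Lemma cvg_cmodP (T : Type) (F : set_system T) {FF : Filter F} (u : T -> Cplx R) (l : Cplx R) :
  u @ F --> l <-> forall e : R, 0 < e -> \forall x \near F, cmod (l - u x) < e.
Proof.
split=> [/cvgrPdist_lt H e e0|H].
  have /H : 0 < e%:C :> Cplx R by rewrite ltcR.
  by apply: filterS => x; rewrite cmodE ltcR.
apply/cvgrPdist_lt => e; rewrite ltcE /= => /andP[/eqP ie re].
apply: filterS (H _ re) => x; rewrite cmodE => hx.
by rewrite ltcE /= ie eqxx.
Qed.

Lemma cvg_ReIm (u : nat -> Cplx R) (l : Cplx R) :
  (fun n => Re (u n)) @ \oo --> Re l -> (fun n => Im (u n)) @ \oo --> Im l ->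
  u @ \oo --> l.
Proof.
move=> /cvgrPdist_lt HR /cvgrPdist_lt HI; apply/cvg_cmodP => e e0.
have e2 : 0 < e / 2 by rewrite divr_gt0.
near=> n; apply: le_lt_trans (cmod_leReIm _) _.
rewrite cReD cImD cReN cImN [ltRHS]splitr ltrD //; near: n; [exact: HR | exact: HI].
Unshelve. all: by end_near. Qed.

Lemma cvg_cmod_squeeze (u : nat -> Cplx R) (v : nat -> R) (l : Cplx R) :
  (forall n, cmod (u n - l) <= v n) -> v @ \oo --> (0 : R) -> u @ \oo --> l.
Proof.
move=> uv /cvgrPdist_lt v0; apply/cvg_cmodP => e e0; apply: filterS (v0 e e0) => n.
rewrite sub0r normrN => vn; rewrite -cmodN opprB.
by apply: le_lt_trans (uv n) (le_lt_trans (ler_norm _) vn).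
Qed.

Lemma cvg_real_complex (u : nat -> R) (l : R) :
  u @ \oo --> l -> (fun n => (u n)%:C : Cplx R) @ \oo --> (l%:C : Cplx R).
Proof. by move=> ul; apply: cvg_ReIm => //=; exact: cvg_cst. Qed.

End ComplexModulus.

Section ComplexExp.
Variable R : realType.
Implicit Types z w : Cplx R.
Local Notation Re := complex.Re.
Local Notation Im := complex.Im.

Lemma cexpD z w : cexp (z + w) = cexp z * cexp w.
Proof.
rewrite /cexp cReD cImD expRD cosD sinD.
by apply: cplxP; rewrite !(cReM, cImM) /=; ring.
Qed.

Lemma cmod_cexp z : cmod (cexp z) = expR (Re z).
Proof.
rewrite cmodM cmod_real ger0_norm ?expR_ge0 // [X in _ * X]cmod_sqrt /=.
by rewrite cos2Dsin2 sqrtr1 mulr1.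
Qed.

Definition exp_sum (K : fieldType) (N : nat) (z : K) : K :=
  \sum_(0 <= i < N) z ^+ i / i`!%:R.

Lemma exp_sumD (K : numFieldType) N (x y : K) :
  exp_sum N (x + y) = \sum_(0 <= i < N) \sum_(0 <= j < N | (i + j < N)%N)
     x ^+ i / i`!%:R * (y ^+ j / j`!%:R).
Proof.
transitivity (\sum_(0 <= k < N) \sum_(0 <= i < N | (i <= k)%N)
     x ^+ i / i`!%:R * (y ^+ (k - i) / (k - i)`!%:R)).
  apply: eq_big_nat => k /andP[_ kN].
  rewrite addrC exprDn mulr_suml
    -(big_mkord xpredT (fun i => (y ^+ (k - i) * x ^+ i *+ 'C(k, i)) / k`!%:R)).
  rewrite (@big_nat_widen _ _ _ 0 k.+1 N) //.
  apply: eq_big => [i|i ik]; first by rewrite ltnS.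
  rewrite -(bin_fact (n := k) (m := i)) // -mulr_natr !natrM.
  have H n : n`!%:R != 0 :> K by rewrite pnatr_eq0 -lt0n fact_gt0.
  have H1 : 'C(k, i)%:R != 0 :> K by rewrite pnatr_eq0 -lt0n bin_gt0.
  by field; rewrite !H H1.
rewrite (exchange_big_dep xpredT) //=.
apply: eq_big_nat => i /andP[_ iN].
have -> : \sum_(0 <= k < N | (i <= k)%N) x ^+ i / i`!%:R * (y ^+ (k - i) / (k - i)`!%:R)
  = \sum_(i <= k < N) x ^+ i / i`!%:R * (y ^+ (k - i) / (k - i)`!%:R).
  by rewrite [RHS](big_nat_widenl i 0) //.
have -> : index_iota i N = index_iota (0 + i) N by rewrite add0n.
rewrite big_addn (@big_nat_widen _ _ _ 0 (N - i) N) ?leq_subr //.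
by apply: eq_big => [j|j _]; [rewrite ltn_subRL | rewrite addnK].
Qed.

Lemma exp_sumM_sub (K : numFieldType) N (x y : K) :
  exp_sum N x * exp_sum N y - exp_sum N (x + y) =
  \sum_(0 <= i < N) \sum_(0 <= j < N | ~~ (i + j < N)%N)
     x ^+ i / i`!%:R * (y ^+ j / j`!%:R).
Proof.
rewrite exp_sumD /exp_sum mulr_suml -sumrB; apply: eq_bigr => i _.
rewrite mulr_sumr (bigID (fun j => i + j < N)%N) /=; ring.
Qed.

(** Both differences are sums over the same pairs i, j < N with i + j >= N, so the triangle
    inequality applies term by term. The right-hand side is a real error, known to tend to 0. *)
Lemma exp_sumM_le (K : numFieldType) N (x y : K) :
  `|exp_sum N x * exp_sum N y - exp_sum N (x + y)| <=
    exp_sum N `|x| * exp_sum N `|y| - exp_sum N (`|x| + `|y|).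
Proof.
rewrite !exp_sumM_sub; apply: le_trans (ler_norm_sum _ _ _) _.
apply: ler_sum => i _; apply: le_trans (ler_norm_sum _ _ _) _.
apply: ler_sum => j _.
by rewrite !normrM !normrX !normfV !normr_nat.
Qed.

Lemma exp_sum_real N (x : R) : exp_sum N (x%:C : Cplx R) = (exp_sum N x)%:C.
Proof.
rewrite /exp_sum rmorph_sum; apply: eq_bigr => i _.
by rewrite rmorphM /= fmorphV /= rmorph_nat rmorphXn.
Qed.

Lemma cvg_exp_sum_real (x : R) : (fun N => exp_sum N x) @ \oo --> expR x.
Proof. exact: is_cvg_series_exp_coeff. Qed.

(** Shaped after the coefficients of cosine and sine; at n = 0 the truncated predecessor is
    harmless, being multiplied by [(odd 0)%:R]. *)
Lemma imX (y : R) n : (0 +i* y : Cplx R) ^+ n =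
  ((~~ odd n)%:R * (-1) ^+ n./2 * y ^+ n) +i* ((odd n)%:R * (-1) ^+ n.-1./2 * y ^+ n).
Proof.
elim: n => [|n IH]; first by apply: cplxP; rewrite /= !(expr0, mulr1, mul0r).
rewrite exprS IH; apply: cplxP; rewrite !(cReM, cImM) /= !mul0r ?sub0r ?add0r.
  rewrite negbK exprS; case: n {IH} => [|n] /=; first by rewrite !mul0r mulr0 oppr0.
  rewrite [(-1) ^+ _.+1]exprS; ring.
rewrite exprS; ring.
Qed.

Lemma cvg_exp_sum_im (y : R) :
  (fun N => exp_sum N (0 +i* y : Cplx R)) @ \oo --> (cos y +i* sin y : Cplx R).
Proof.
have E n : (0 +i* y : Cplx R) ^+ n / n`!%:R = cos_coeff y n +i* sin_coeff y n.
  have -> : n`!%:R^-1 = (n`!%:R^-1)%:C :> Cplx R by rewrite fmorphV rmorph_nat.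
  rewrite imX; apply: cplxP; rewrite !(cReM, cImM) /= mulr0 ?subr0 ?add0r //.
apply: cvg_ReIm.
  have H : series (cos_coeff y) @ \oo --> cos y.
    by rewrite unlock; exact: is_cvg_series_cos_coeff.
  apply: cvg_trans H.
  apply: near_eq_cvg; near=> N; rewrite /exp_sum Re_sum /series /=.
  by apply: eq_bigr => n _; rewrite E.
have H : series (sin_coeff y) @ \oo --> sin y.
    by rewrite unlock; exact: is_cvg_series_sin_coeff.
  apply: cvg_trans H.
apply: near_eq_cvg; near=> N; rewrite /exp_sum Im_sum /series /=.
by apply: eq_bigr => n _; rewrite E.
Unshelve. all: by end_near. Qed.

(** [cexp] is defined by real functions; its power series is needed for the Taylor expansion of
    n^(-s) in s. The real and imaginary parts of z are treated separately and the partial sums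
    multiplied. *)
Lemma cvg_exp_sum z : (fun N => exp_sum N z) @ \oo --> cexp z.
Proof.
pose x : Cplx R := (Re z)%:C; pose w : Cplx R := 0 +i* Im z.
have zE : z = x + w by apply: cplxP; rewrite ?cReD ?cImD /= ?addr0 ?add0r.
have H1 : (fun N => exp_sum N x * exp_sum N w) @ \oo --> cexp z.
  apply: cvgM; last exact: cvg_exp_sum_im.
  under eq_fun do rewrite exp_sum_real.
  exact/cvg_real_complex/cvg_exp_sum_real.
have H2 : (fun N => exp_sum N x * exp_sum N w - exp_sum N z) @ \oo --> (0 : Cplx R).
  pose a := cmod x; pose b := cmod w.
  apply: (@cvg_cmod_squeeze _ _ (fun N => exp_sum N a * exp_sum N b - exp_sum N (a + b))).
    move=> N; rewrite subr0 zE -lecR -cmodE.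
    apply: le_trans (exp_sumM_le N x w) _.
    by rewrite !cmodE -rmorphD !exp_sum_real -rmorphM -rmorphB.
  rewrite -[0](subrr (expR a * expR b)) -{2}expRD; apply: cvgB; last exact: cvg_exp_sum_real.
  by apply: cvgM; exact: cvg_exp_sum_real.
rewrite -[cexp z]subr0.
have -> : (fun N => exp_sum N z) =
    (fun N => exp_sum N x * exp_sum N w - (exp_sum N x * exp_sum N w - exp_sum N z)).
  by apply/funext => N; rewrite opprB addrC subrK.
exact: cvgB H1 H2.
Qed.

End ComplexExp.

(** * Size of the differences of n^(-s) *)

Section DifferenceBound.
Variable R : realType.
Implicit Types (f g : R -> R) (a b h : R).

Fixpoint deriv_bound a b k f (B : R) : Prop :=
  if k is k'.+1 then
    exists2 f', (forall y, a <= y <= b -> is_derive y 1 f (f' y)) & deriv_bound a b k' f' B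
  else forall y, a <= y <= b -> `|f y| <= B.

Lemma deriv_boundD a b k f g B C : deriv_bound a b k f B -> deriv_bound a b k g C ->
  deriv_bound a b k (fun y => f y + g y) (B + C).
Proof.
elim: k f g => [|k IH] f g /=.
  move=> Hf Hg y yab; apply: le_trans (ler_normD _ _) _.
  by apply: lerD; [exact: Hf | exact: Hg].
move=> [f' Hf Hf'] [g' Hg Hg']; exists (fun y => f' y + g' y); last exact: IH.
by move=> y yab; apply: is_deriveD; [exact: Hf | exact: Hg].
Qed.

Lemma deriv_boundZ a b k f B c : deriv_bound a b k f B ->
  deriv_bound a b k (fun y => c * f y) (`|c| * B).
Proof.
elim: k f => [|k IH] f /=.
  by move=> Hf y yab; rewrite normrM ler_wpM2l // Hf.
move=> [f' Hf Hf']; exists (fun y => c * f' y); last exact: IH.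
by move=> y yab; apply: (@is_deriveZ _ _ _ f c y 1 (f' y)); exact: Hf.
Qed.

Local Notation shiftdiff h := (fdiff (fun y : R => y + h)).

Lemma is_derive_iter_fdiff a b h k f f' y : 0 <= h ->
  (forall y, a <= y <= b -> is_derive y 1 f (f' y)) ->
  a <= y -> y + k%:R * h <= b ->
  is_derive y 1 (iter k (shiftdiff h) f) (iter k (shiftdiff h) f' y).
Proof.
move=> h0 Hf; elim: k y => [|k IH] y ay yb.
  by apply: Hf; rewrite ay /=; move: yb; rewrite mul0r addr0.
have yb' : y + h + k%:R * h <= b by move: yb; rewrite -natr1 mulrDl mul1r; lra.
have D1 : is_derive y 1 (iter k (shiftdiff h) f) (iter k (shiftdiff h) f' y).
  by apply: IH => //; lra.
have D2 : is_derive (y + h) 1 (iter k (shiftdiff h) f) (iter k (shiftdiff h) f' (y + h)).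
  by apply: IH => //; lra.
have D3 : is_derive y 1 (fun x : R => x + h) 1.
  have := @is_deriveD _ _ _ id (cst h) y 1 1 0 _ _.
  by rewrite addr0; apply.
have D4 := @is_derive1_comp _ (iter k (shiftdiff h) f) (fun x => x + h) y _ _ D2 D3.
by have := is_deriveB D1 D4; rewrite mulr1.
Qed.

(** By the mean value theorem, the difference of order k+1 of f is -h times the difference of order
    k of f' at an intermediate point. *)
Lemma fdiff_bound a b h k f B y : 0 < h -> deriv_bound a b k f B ->
  a <= y -> y + k%:R * h <= b ->
  `|iter k (shiftdiff h) f y| <= h ^+ k * B.
Proof.
move=> h0; elim: k f y => [|k IH] f y /=.
  by move=> Hf ay yb; rewrite expr0 mul1r Hf // ay; move: yb; rewrite mul0r addr0.
move=> [f' Hf Hf'] ay yb.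
have yb' : y + h + k%:R * h <= b by move: yb; rewrite -natr1 mulrDl mul1r; lra.
have D x : y <= x <= y + h ->
    is_derive x 1 (iter k (shiftdiff h) f) (iter k (shiftdiff h) f' x).
  move=> /andP[yx xy]; apply: (@is_derive_iter_fdiff a b) => //; lra.
have yyh : y <= y + h by lra.
have [||c] := @MVT_segment _ (iter k (shiftdiff h) f) (iter k (shiftdiff h) f') y (y + h) yyh.
- by move=> x; rewrite in_itv /= => /andP[yx xy]; apply: D; rewrite !ltW.
- apply: derivable_within_continuous => x; rewrite in_itv /= => /D Dx.
  exact: ex_derive.
rewrite in_itv /= => /andP[yc cy] E.
rewrite -[X in `|X|]/(iter k (shiftdiff h) f y - iter k (shiftdiff h) f (y + h)) distrC E.
rewrite addrAC subrr add0r normrM [`|h|]gtr0_norm //.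
rewrite mulrC exprS -mulrA (ler_wpM2l (ltW h0)) //.
apply: IH => //; lra.
Qed.

End DifferenceBound.

Section LogPowerFamily.
Variables (R : realType) (sg tu : R).

(* For phi = 0 and phi = pi/2 these are, up to sign, the real and imaginary parts of
   y^(-s-p) (ln y)^i / i! with s = sg + i tu; quarter turns of phi make the family stable
   under differentiation. *)
Definition logpow (phi : R) (i p : nat) (y : R) : R :=
  expR (- (sg + p%:R) * ln y) * cos (tu * ln y + phi) * (ln y ^+ i / i`!%:R).

(** Computed in the variable z = ln y. The chain rule contributes 1/y, which raises p by one, and
    differentiating the cosine is a quarter turn of phi. *)
Lemma is_derive_logpow phi i p (y : R) : 0 < y ->
  is_derive y 1 (logpow phi i p)
    ((if i is i'.+1 then logpow phi i' p.+1 y else 0)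
      + (- (sg + p%:R)) * logpow phi i p.+1 y + tu * logpow (phi + pi / 2) i p.+1 y).
Proof.
move=> y0; set c := - (sg + p%:R); set z := ln y.
have Dc k : is_derive z 1 (fun z : R => k * z) k.
  have := @is_deriveZ _ _ _ (@id R) k z 1 1 (is_derive_id z 1).
  by rewrite [_ *: 1]mulr1.
have Dlin k l : is_derive z 1 (fun z : R => k * z + l) k.
  by have := is_deriveD (Dc k) (is_derive_cst l z 1); rewrite addr0.
have D1 : is_derive z 1 (fun z : R => expR (c * z)) (c * expR (c * z)).
  have := is_derive1_comp (is_derive_expR (c * z)) (Dc c).
  by rewrite mulrC.
have D2 : is_derive z 1 (fun z : R => cos (tu * z + phi)) (tu * cos (tu * z + (phi + pi / 2))).
  have := @is_derive1_comp _ cos (fun z => tu * z + phi) z _ _ (is_derive_cos _) (Dlin tu phi).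
  by rewrite addrA cosDpihalf mulrC.
pose df := if i is i'.+1 then z ^+ i' / i'`!%:R else 0.
have D3 : is_derive z 1 (fun z : R => z ^+ i / i`!%:R) df.
  have -> : (fun z : R => z ^+ i / i`!%:R) = (@id R) ^+ i * cst i`!%:R^-1.
    by apply/funext => w; rewrite !fctE.
  have DX : is_derive z 1 ((@id R) ^+ i) ((i%:R * z ^+ i.-1) *: (1 : R)).
    exact: (@is_deriveX R R (@id R) i z 1 1 (is_derive_id z 1)).
  apply: (is_derive_eq (is_deriveM DX (is_derive_cst (i`!%:R^-1 : R) z 1))).
  rewrite scaler0 add0r /df; case: i {df DX} => [|i] /=.
    by rewrite mul0r scale0r scaler0.
  have H' : i.+1%:R != 0 :> R by rewrite pnatr_eq0.
  rewrite factS natrM /cst /=.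
  rewrite -[LHS]/((i.+1%:R * i`!%:R)^-1 * (i.+1%:R * z ^+ i * 1)).
  by rewrite mulr1 invfM mulrACA mulVf // mul1r mulrC.
have D4 := is_deriveM (is_deriveM D1 D2) D3.
have D5 := is_derive1_comp D4 (is_derive1_ln y0).
apply: (@is_derive_eq _ _ _ (logpow phi i p) y 1 _ _ D5).
have E : expR (- (sg + p.+1%:R) * z) = expR (c * z) * y^-1.
  rewrite -natr1 /c.
  have -> : - (sg + (p%:R + 1)) * z = - (sg + p%:R) * z + - z by ring.
  by rewrite expRD expRN /z lnK.
rewrite /logpow -/z E.
rewrite -[LHS]/((expR (c * z) * cos (tu * z + phi) * df + (z ^+ i / i`!%:R) *
  (expR (c * z) * (tu * cos (tu * z + (phi + pi / 2))) + cos (tu * z + phi) * (c * expR (c * z)))) / y).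
by rewrite /df; case: i {df D3 D4 D5} => [|i]; ring.
Qed.

Variables (n : R) (Y : R).
Hypotheses (n1 : 1 <= n) (nY : n <= Y).

(** Follows the derivative formula. In the base case, for y between n and Y, the factor y^(-sg) is
    bounded by Y^|sg| and y^(-p) by n^(-p). *)
Fixpoint logpow_bound (k i p : nat) : R :=
  if k is k'.+1 then
    (if i is i'.+1 then logpow_bound k' i' p.+1 else 0)
      + `|- (sg + p%:R)| * logpow_bound k' i p.+1 + `|tu| * logpow_bound k' i p.+1
  else expR (`|sg| * ln Y) * expR (- p%:R * ln n) * (ln Y ^+ i / i`!%:R).

Lemma deriv_bound_logpow k i p phi :
  deriv_bound n Y k (logpow phi i p) (logpow_bound k i p).
Proof.
elim: k i p phi => [|k IH] i p phi /=.
  move=> y /andP[ny yY].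
  have n0 : 0 < n by apply: lt_le_trans n1.
  have y0 : 0 < y by apply: lt_le_trans ny.
  have ln0 : 0 <= ln y by rewrite ln_ge0 // (le_trans n1).
  have lny : ln y <= ln Y by rewrite ler_ln // posrE (lt_le_trans y0).
  rewrite /logpow !normrM ler_pM ?mulr_ge0 //.
    rewrite (ger0_norm (expR_ge0 _)) -[leRHS]mulr1 ler_pM ?expR_ge0 //; last exact: cos_max.
    rewrite -expRD ler_expR opprD mulrDl lerD //.
      apply: le_trans (ler_norm _) _; rewrite normrM normrN (ger0_norm ln0).
      by rewrite ler_wpM2l.
    by rewrite !mulNr lerN2 ler_wpM2l // ler_ln ?posrE.
  rewrite normrX normfV normr_nat (ger0_norm ln0) ler_wpM2r ?invr_ge0 //.
  by rewrite lerXn2r ?nnegrE // (le_trans ln0).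
exists (fun y => (if i is i'.+1 then logpow phi i' p.+1 y else 0)
      + (- (sg + p%:R)) * logpow phi i p.+1 y + tu * logpow (phi + pi / 2) i p.+1 y).
  move=> y /andP[ny _]; apply: is_derive_logpow.
  by apply: lt_le_trans ny; apply: lt_le_trans n1.
apply: deriv_boundD; last exact: deriv_boundZ.
apply: deriv_boundD; last exact: deriv_boundZ.
case: i => [|i]; last exact: IH.
(* For i = 0 the first term is the zero function, seen as 0 times a member of the family. *)
have := deriv_boundZ 0 (IH 0%N p.+1 phi); rewrite normr0 mul0r.
by under eq_fun do rewrite mul0r.
Qed.

Lemma logpow_bound_ge0 k i p : 0 <= logpow_bound k i p.
Proof.
have Y0 : 0 <= ln Y by rewrite ln_ge0 // (le_trans n1).
elim: k i p => [|k IH] i p /=.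
  by rewrite !mulr_ge0 ?expR_ge0 // ?exprn_ge0 ?invr_ge0.
by rewrite !addr_ge0 ?mulr_ge0 //; case: i.
Qed.

Lemma exp_sum_le (x : R) N : 0 <= x -> exp_sum N x <= expR x.
Proof.
move=> x0; have H := @cvg_exp_sum_real R x.
rewrite -(cvg_lim _ H) //; apply: limr_ge; first exact: cvgP H.
near=> M; have NM : (N <= M)%N by near: M; exact: nbhs_infty_ge.
rewrite /exp_sum [leRHS](big_cat_nat _ NM) //= lerDl sumr_ge0 // => i _.
by rewrite mulr_ge0 ?exprn_ge0 ?invr_ge0.
Unshelve. all: by end_near. Qed.

(** The sum of (ln Y)^i / i! is at most Y, whence uniformity in N. Each derivative costs at most the
    displayed base, and p + k stays constant along the induction. *)
Lemma sum_logpow_bound k p N :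
  \sum_(0 <= i < N) logpow_bound k i p <=
  (1 + `|sg| + `|tu| + (p + k)%:R) ^+ k *
  (expR (`|sg| * ln Y) * expR (- (p + k)%:R * ln n) * expR (ln Y)).
Proof.
have Y0 : 0 <= ln Y by rewrite ln_ge0 // (le_trans n1).
elim: k p N => [|k IH] p N.
  rewrite expr0 mul1r addn0 /= -mulr_sumr.
  by rewrite ler_wpM2l ?mulr_ge0 ?expR_ge0 //; exact: exp_sum_le.
set Z := expR _ * _ * _.
have IH' M : \sum_(0 <= i < M) logpow_bound k i p.+1 <=
    (1 + `|sg| + `|tu| + (p + k.+1)%:R) ^+ k * Z.
  by have := IH p.+1 M; rewrite addSnnS.
rewrite /= 2!big_split /= -!mulr_sumr.
have H1 : \sum_(0 <= i < N) (if i is i'.+1 then logpow_bound k i' p.+1 else 0) <=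
    (1 + `|sg| + `|tu| + (p + k.+1)%:R) ^+ k * Z.
  case: N => [|N]; first by apply: le_trans (IH' 0%N); rewrite !big_geq.
  by rewrite big_nat_recl //= add0r.
have ZZ : 0 <= (1 + `|sg| + `|tu| + (p + k.+1)%:R) ^+ k * Z.
  by rewrite !mulr_ge0 ?expR_ge0 ?exprn_ge0 // !addr_ge0.
rewrite exprS -mulrA.
have H2 : `|- (sg + p%:R)| <= `|sg| + (p + k.+1)%:R.
  rewrite normrN; apply: le_trans (ler_normD _ _) _.
  by rewrite lerD2l normr_nat ler_nat leq_addr.
set V := _ ^+ k * Z in IH' H1 ZZ *.
have -> : (1 + `|sg| + `|tu| + (p + k.+1)%:R) * V =
  V + (`|sg| + (p + k.+1)%:R) * V + `|tu| * V by ring.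
apply: lerD; last exact: ler_wpM2l.
apply: lerD => //.
by apply: ler_pM => //; apply: sumr_ge0 => i _; exact: logpow_bound_ge0.
Qed.

End LogPowerFamily.

Lemma iter_fdiffZ (K : pzRingType) (T : Type) (tau : T -> T) k (c : K) (f : T -> K) x :
  iter k (fdiff tau) (fun y => c * f y) x = c * iter k (fdiff tau) f x.
Proof. by elim: k x => [//|k IH] x /=; rewrite /fdiff !IH mulrBr. Qed.

Lemma iter_fdiff_morph (K V : zmodType) (T U : Type) (tau : T -> T) (rho : U -> U)
    (m : K -> V) (e : T -> U) (f : T -> K) (g : U -> V) k x :
  (forall a b, m (a - b) = m a - m b) -> (forall x, e (tau x) = rho (e x)) ->
  (forall x, m (f x) = g (e x)) ->
  m (iter k (fdiff tau) f x) = iter k (fdiff rho) g (e x).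
Proof.
move=> mB eS fg; elim: k x => [|k IH] x /=; first exact: fg.
by rewrite {1}/fdiff mB !IH eS.
Qed.

Section DirichletTerms.
Variable R : realType.
Implicit Types s : Cplx R.
Local Notation Re := complex.Re.
Local Notation Im := complex.Im.
Local Notation Delta := (fdiff (addn^~ 10)).

(* The i-th Taylor coefficient of n^(-s) in s. *)
Definition npow_coef s i n : Cplx R :=
  npow_opp n s * ((- ln n%:R) ^+ i / i`!%:R)%:C.

Lemma npow_coefE s i n : npow_coef s i n =
  ((-1) ^+ i * logpow (Re s) (Im s) 0 i 0 n%:R) +i*
  ((-1) ^+ i * logpow (Re s) (Im s) (pi / 2) i 0 n%:R).
Proof.
rewrite /npow_coef /npow_opp /cexp /logpow addr0.
have -> : Re (- s * (ln n%:R)%:C) = - Re s * ln n%:R.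
  by rewrite cReM cReN /= mulr0 subr0.
have -> : Im (- s * (ln n%:R)%:C) = - (Im s * ln n%:R).
  by rewrite cImM cImN /= mulr0 add0r mulNr.
rewrite cosN sinN addr0 cosDpihalf [(- ln _) ^+ i]exprNn.
by apply: cplxP; rewrite !(cReM, cImM) /=; ring.
Qed.

(** With Y = (1 + 10k) n the previous bound is a constant times n^(-k) Y^(|Re s| + 1), which is
    O(n^(-2)) once k >= |Re s| + 3. Uniformity in N controls the differenced Taylor series at
    distance at most 1 from s. *)
Lemma npow_coef_sum_bound s k : `|Re s| + 3 <= k%:R -> exists C : R, 0 <= C /\
  forall n N, (0 < n)%N ->
    \sum_(0 <= i < N) cmod (iter k Delta (npow_coef s i) n) <= C / n%:R ^+ 2.
Proof.
move=> sk; set sg := Re s; set tu := Im s.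
(* The 2 comes from adding real and imaginary parts, 10^k from the step of the differences, the
   exponential from the constant 1 + 10k in Y. *)
pose C0 := 2 * 10 ^+ k * (1 + `|sg| + `|tu| + k%:R) ^+ k * expR ((`|sg| + 1) * ln (1 + 10 * k%:R)).
exists C0; split; first by rewrite !mulr_ge0 ?expR_ge0 ?exprn_ge0 // !addr_ge0.
move=> n N n0.
have n1 : 1 <= n%:R :> R by rewrite ler1n.
pose Y : R := (1 + 10 * k%:R) * n%:R.
have k0 : 0 <= k%:R :> R by [].
have nY : n%:R <= Y by rewrite /Y; nra.
have nY' : n%:R + k%:R * 10 <= Y by rewrite /Y; nra.
have B phi i : `|iter k (fdiff (fun y : R => y + 10)) (logpow sg tu phi i 0) n%:R| <=
    10 ^+ k * logpow_bound sg tu n%:R Y k i 0.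
  have h10 : 0 < 10 :> R by [].
  exact: fdiff_bound h10 (deriv_bound_logpow sg tu Y n1 k i 0 phi) (lexx _) nY'.
have T i : cmod (iter k Delta (npow_coef s i) n) <=
    2 * 10 ^+ k * logpow_bound sg tu n%:R Y k i 0.
  apply: le_trans (cmod_leReIm _) _.
  have eS (m : nat) : (m + 10)%:R = m%:R + 10 :> R by rewrite natrD.
  have -> : Re (iter k Delta (npow_coef s i) n) =
      (-1) ^+ i * iter k (fdiff (fun y : R => y + 10)) (logpow sg tu 0 i 0) n%:R.
    rewrite -iter_fdiffZ; apply: iter_fdiff_morph => // [a b|m]; first by rewrite cReD cReN.
    by rewrite npow_coefE.
  have -> : Im (iter k Delta (npow_coef s i) n) =
      (-1) ^+ i * iter k (fdiff (fun y : R => y + 10)) (logpow sg tu (pi / 2) i 0) n%:R.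
    rewrite -iter_fdiffZ; apply: iter_fdiff_morph => // [a b|m]; first by rewrite cImD cImN.
    by rewrite npow_coefE.
  rewrite !normrM !normrX normrN1 expr1n !mul1r.
  by apply: le_trans (lerD (B _ _) (B _ _)) _; rewrite -mulrA mulr2n mulrDl !mul1r.
apply: le_trans (ler_sum _ (fun i _ => T i)) _.
rewrite -mulr_sumr.
apply: le_trans (ler_wpM2l _ (sum_logpow_bound sg tu n1 nY k 0 N)) _.
  by rewrite mulr_ge0.
rewrite add0n /C0 -!mulrA !ler_wpM2l ?exprn_ge0 ?addr_ge0 //.
have n0' : 0 < n%:R :> R by rewrite ltr0n.
have -> : n%:R ^- 2 = expR (- 2 * ln n%:R) :> R.
  by rewrite mulNr expRN expRM_natl lnK // posrE.
have k10 : 0 < 1 + 10 * k%:R :> R by apply: ltr_pwDl => //; rewrite mulr_ge0.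
rewrite /Y lnM ?posrE // -!expRD ler_expR.
have : 0 <= ln n%:R :> R by rewrite ln_ge0.
move: sk; rewrite -/sg; move: (ln n%:R) (ln (1 + _)) => a b ska a0.
have : 0 <= (k%:R - `|sg| - 3) * a by rewrite mulr_ge0 //; lra.
lra.
Qed.

End DirichletTerms.

(** * Absolutely convergent complex series and exchange of summation *)

Section ComplexSeries.
Variable R : realType.
Implicit Types (c d : nat -> Cplx R).
Local Notation Re := complex.Re.
Local Notation Im := complex.Im.

Lemma cvg_series_abs c (B : R) : (forall N, \sum_(0 <= n < N) cmod (c n) <= B) ->
  exists l : Cplx R, series c @ \oo --> l.
Proof.
move=> cB.
have cvg_abs : cvgn (series (fun n => cmod (c n))).
  apply: nondecreasing_is_cvgn.
    by apply: nondecreasing_series => n _ _; exact: cmod_ge0.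
  by exists B => _ [N _ <-]; exact: cB.
have HR : cvgn (series (fun n => Re (c n))).
  apply: normed_cvg; apply: (series_le_cvg _ _ _ cvg_abs) => n.
  - exact: normr_ge0.
  - exact: cmod_ge0.
  - exact: normRe_le.
have HI : cvgn (series (fun n => Im (c n))).
  apply: normed_cvg; apply: (series_le_cvg _ _ _ cvg_abs) => n.
  - exact: normr_ge0.
  - exact: cmod_ge0.
  - exact: normIm_le.
exists (limn (series (fun n => Re (c n))) +i* limn (series (fun n => Im (c n)))).
apply: cvg_ReIm => /=.
  by under eq_fun do rewrite /series /= Re_sum; exact: HR.
by under eq_fun do rewrite /series /= Im_sum; exact: HI.
Qed.

Lemma cmod_lim_le (u : nat -> Cplx R) (l v : Cplx R) (e : R) : u @ \oo --> l ->
  (\forall n \near \oo, cmod (u n - v) <= e) -> cmod (l - v) <= e.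
Proof.
move=> /cvg_cmodP ul un; apply/ler_addgt0Pr => r r0.
near \oo => n.
have -> : l - v = (u n - v) + (l - u n) by ring.
apply: le_trans (cmodD _ _) (lerD _ _); first by near: n.
by apply: ltW; near: n; exact: ul.
Unshelve. all: by end_near. Qed.

Lemma cvg_sum (r : seq nat) (f : nat -> nat -> Cplx R) (l : nat -> Cplx R) :
  (forall i, f i @ \oo --> l i) ->
  (fun N => \sum_(i <- r) f i N) @ \oo --> \sum_(i <- r) l i.
Proof.
move=> fl; elim: r => [|a r IH].
  by rewrite big_nil; under eq_fun do rewrite big_nil; exact: cvg_cst.
rewrite big_cons; under eq_fun do rewrite big_cons.
exact: cvgD (fl a) IH.
Qed.

(** Rows are dominated by a summable M: those from J on contribute at most e/3 in either order of
    summation, and the finitely many others can be exchanged with the limit. *)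
Lemma cvg_double_series (x : nat -> nat -> Cplx R) (M : nat -> R) (B : R)
    (d A : nat -> Cplx R) (T : Cplx R) :
  (forall j N, \sum_(0 <= i < N) cmod (x j i) <= M j) ->
  (forall J, \sum_(0 <= j < J) M j <= B) ->
  (forall j, series (x j) @ \oo --> d j) ->
  series d @ \oo --> T ->
  (forall i, series (x^~ i) @ \oo --> A i) ->
  series A @ \oo --> T.
Proof.
move=> xM MB xd dT xA.
have M0 j : 0 <= M j by have := xM j 0%N; rewrite big_geq.
have cvgM : cvgn (series M).
  apply: nondecreasing_is_cvgn; first by apply: nondecreasing_series => n _ _.
  by exists B => _ [N _ <-]; exact: MB.
apply/cvg_cmodP => e e0.
have e3 : 0 < e / 3 by rewrite divr_gt0.
have [J HJ] : exists J, forall J', (J <= J')%N -> \sum_(J <= j < J') M j <= e / 3.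
  have /cvgrPdist_lt/(_ (e / 3 / 2)) := cvgM.
  rewrite divr_gt0 // => /(_ isT) [J _ HJ]; exists J => J' JJ'.
  have := HJ J (leqnn J); have := HJ J' JJ'.
  have -> : \sum_(J <= j < J') M j = series M J' - series M J by rewrite sub_series_geq.
  move: (limn _) (series M J') (series M J) => l a b /=.
  rewrite !ltr_norml => /andP[h1 h2] /andP[h3 h4]; lra.
have dM j : cmod (d j) <= M j.
  have := @cmod_lim_le _ _ 0 (M j) (xd j); rewrite subr0; apply.
  near=> N; rewrite subr0; apply: le_trans (cmod_sum _ _ _) _; exact: xM.
have Td : cmod (T - series d J) <= e / 3.
  apply: (cmod_lim_le dT); near=> N.
  have JN : (J <= N)%N by near: N; exact: nbhs_infty_ge.
  rewrite sub_series_geq //; apply: le_trans (cmod_sum _ _ _) _.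
  by apply: le_trans (HJ N JN); apply: ler_sum => j _.
have AI N : cmod (series A N - \sum_(0 <= i < N) series (x^~ i) J) <= e / 3.
  have H : (fun J' => \sum_(0 <= i < N) series (x^~ i) J') @ \oo --> series A N.
    by rewrite /series; apply: cvg_sum => i; exact: xA.
  apply: (cmod_lim_le H); near=> J'.
  have JJ' : (J <= J')%N by near: J'; exact: nbhs_infty_ge.
  rewrite -sumrB.
  under eq_bigr do rewrite sub_series_geq //.
  rewrite exchange_big /=; apply: le_trans (cmod_sum _ _ _) _.
  apply: le_trans (HJ J' JJ'); apply: ler_sum => j _.
  by apply: le_trans (cmod_sum _ _ _) _; exact: xM.
have Hd : (fun N => \sum_(0 <= i < N) series (x^~ i) J) @ \oo --> series d J.
  have -> : (fun N => \sum_(0 <= i < N) series (x^~ i) J) =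
      (fun N => \sum_(0 <= j < J) series (x j) N).
    by apply/funext => N; rewrite /series /= exchange_big.
  by rewrite /series; apply: cvg_sum => i; exact: xd.
move/cvg_cmodP : Hd => /(_ _ e3) Hd.
near=> N.
have HN : cmod (series d J - \sum_(0 <= i < N) series (x^~ i) J) < e / 3 by near: N.
have -> : T - series A N = (T - series d J) + (series d J - \sum_(0 <= i < N) series (x^~ i) J)
  + - (series A N - \sum_(0 <= i < N) series (x^~ i) J) by ring.
apply: le_lt_trans (cmodD _ _) _; rewrite cmodN.
have := cmodD (T - series d J) (series d J - \sum_(0 <= i < N) series (x^~ i) J).
have := AI N; lra.
Unshelve. all: by end_near. Qed.

End ComplexSeries.

(** * Analytic continuation *)

Section Continuation.
Variables (R : realType) (chi : nat -> int).
Hypothesis chi_anti : forall n, chi (n + 10)%N = - chi n.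
Hypothesis chi_le1 : forall n, `|chi n| <= 1.
Implicit Types s z : Cplx R.
Local Notation Re := complex.Re.
Local Notation Delta := (fdiff (addn^~ 10)).
Local Notation npow s := (fun n : nat => npow_opp n s).
Local Notation X n := ((chi n)%:~R : Cplx R).

Lemma cmod_chiM n z : cmod (X n * z) <= cmod z.
Proof.
rewrite cmodM -[leRHS]mul1r ler_wpM2r ?cmod_ge0 //.
by rewrite -lecR -cmodE -intr_norm rmorph1 -[leRHS]/(1%:~R) ler_int.
Qed.

(** Boundary terms left on the half-period 1, ..., 10 by k summations by parts. *)
Definition euler_head k (f : nat -> Cplx R) : Cplx R :=
  \sum_(1 <= n < 11) X n * \sum_(0 <= i < k) 2^-1 ^+ i.+1 * iter i Delta f n.

(* Euler-transformed partial sum of [sum chi(n) f(n)]: since chi changes sign under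
   n -> n + 10, summation by parts trades f for (f - f(. + 10)) / 2. *)
Definition euler_sum k (f : nat -> Cplx R) (N : nat) : Cplx R :=
  euler_head k f + 2^-1 ^+ k * \sum_(0 <= n < N) X n.+1 * iter k Delta f n.+1.

Lemma euler_headS k f : euler_head k.+1 f =
  euler_head k f + 2^-1 ^+ k.+1 * \sum_(1 <= n < 11) X n * iter k Delta f n.
Proof.
rewrite /euler_head mulr_sumr -big_split /=; apply: eq_bigr => n _.
by rewrite big_nat_recr //= mulrDr; congr (_ + _); ring.
Qed.

(** By antiperiodicity -chi(n) g(n+10) = chi(n+10) g(n+10), so the differenced sum is the original
    one plus its shift by 10. The two agree up to the first ten terms, absorbed by the head, and ten
    terms at the far end. *)
Lemma euler_sumS k f N : euler_sum k.+1 f N =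
  euler_sum k f N + 2^-1 ^+ k.+1 * \sum_(N <= n < N + 10) X n.+1 * iter k Delta f n.+1.
Proof.
rewrite /euler_sum euler_headS; set g := iter k Delta f.
have E1 : \sum_(0 <= n < N) X n.+1 * iter k.+1 Delta f n.+1 =
    \sum_(0 <= n < N) X n.+1 * g n.+1 + \sum_(10 <= n < N + 10) X n.+1 * g n.+1.
  have -> : \sum_(10 <= n < N + 10) X n.+1 * g n.+1 =
      \sum_(0 <= n < N) X (n + 10).+1 * g (n + 10).+1.
    by rewrite -[in LHS](add0n 10%N) big_addn addnK.
  rewrite -big_split; apply: eq_bigr => n _ /=.
  by rewrite -[(n + 10).+1]addSn chi_anti mulrNz mulNr -mulrBr.
have E2 : \sum_(1 <= n < 11) X n * g n = \sum_(0 <= n < 10) X n.+1 * g n.+1.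
  by rewrite big_add1.
have E3 : \sum_(0 <= n < 10) X n.+1 * g n.+1 + \sum_(10 <= n < N + 10) X n.+1 * g n.+1 =
    \sum_(0 <= n < N) X n.+1 * g n.+1 + \sum_(N <= n < N + 10) X n.+1 * g n.+1.
  by rewrite -!big_cat_nat ?leq_addl ?leq_addr.
rewrite E1 E2 exprS.
have -> : \sum_(10 <= n < N + 10) X n.+1 * g n.+1 = \sum_(0 <= n < N) X n.+1 * g n.+1
    + \sum_(N <= n < N + 10) X n.+1 * g n.+1 - \sum_(0 <= n < 10) X n.+1 * g n.+1.
  by rewrite -E3 addrAC subrr add0r.
by field.
Qed.

Lemma cvg_euler_sumS k f (l : Cplx R) : iter k Delta f @ \oo --> (0 : Cplx R) ->
  euler_sum k f @ \oo --> l <-> euler_sum k.+1 f @ \oo --> l.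
Proof.
move=> g0; set g := iter k Delta f in g0.
have w0 : (fun N => 2^-1 ^+ k.+1 * \sum_(N <= n < N + 10) X n.+1 * g n.+1) @ \oo --> (0 : Cplx R).
  suff H : (fun N => \sum_(N <= n < N + 10) X n.+1 * g n.+1) @ \oo --> (0 : Cplx R).
    by have := cvgMl_tmp (a := 2^-1 ^+ k.+1) H; rewrite mulr0; apply.
  (* Ten terms of size at most e/11 keep the total strictly below e. *)
  apply/cvg_cmodP => e e0; move/cvg_cmodP: g0 => /(_ (e / 11)).
  rewrite divr_gt0 // => /(_ isT) [N0 _ H]; exists N0 => // N /= N0N.
  rewrite sub0r cmodN; apply: le_lt_trans (cmod_sum _ _ _) _.
  apply: (@le_lt_trans _ _ (\sum_(N <= n < N + 10) (e / 11))).
    apply: ler_sum_nat => n /andP[Nn _]; apply: le_trans (cmod_chiM _ _) _.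
    have := H n.+1; rewrite /= sub0r cmodN => /(_ _)/ltW; apply.
    exact: leq_trans N0N (leqW Nn).
  by rewrite sumr_const_nat addKn; lra.
have E : euler_sum k.+1 f = (fun N => euler_sum k f N +
    2^-1 ^+ k.+1 * \sum_(N <= n < N + 10) X n.+1 * g n.+1).
  by apply/funext => N; rewrite euler_sumS.
split=> H.
  by rewrite E; have := cvgD H w0; rewrite addr0; apply.
have -> : euler_sum k f = (fun N => euler_sum k.+1 f N -
    2^-1 ^+ k.+1 * \sum_(N <= n < N + 10) X n.+1 * g n.+1).
  by apply/funext => N; rewrite euler_sumS addrK.
by have := cvgB H w0; rewrite subr0; apply.
Qed.

Lemma npow_coef0 s n : npow_coef s 0 n = npow_opp n s.
Proof. by rewrite /npow_coef expr0 fact0 divr1 mulr1. Qed.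

Lemma iter_npow_bound s k : `|Re s| + 3 <= k%:R -> exists C : R, 0 <= C /\
  forall n, (0 < n)%N -> cmod (iter k Delta (npow s) n) <= C / n%:R ^+ 2.
Proof.
move=> /npow_coef_sum_bound[C [C0 H]]; exists C; split=> // n n0.
have := H n 1%N n0; rewrite big_nat1.
by rewrite (eq_iter_fdiff _ _ (npow_coef0 s)).
Qed.

(** The sharper bound makes the induction work: 2/a - 2/(a+1) >= 1/a^2 for a >= 1. *)
Lemma sum_invsq_le N : \sum_(0 <= n < N) (n.+1%:R ^+ 2)^-1 <= 2 - 2 / N.+1%:R :> R.
Proof.
elim: N => [|N IH]; first by rewrite big_geq // divr1 subrr.
rewrite big_nat_recr //=; apply: le_trans (lerD IH (lexx _)) _.
rewrite -[N.+2%:R]natr1; have : 1 <= N.+1%:R :> R by rewrite ler1n.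
move: (N.+1%:R : R) {IH} => a a1.
have a0 : a != 0 by rewrite gt_eqF //; lra.
have a0' : a + 1 != 0 by rewrite gt_eqF //; lra.
rewrite -subr_ge0.
have -> : 2 - 2 / (a + 1) - (2 - 2 / a + (a ^+ 2)^-1) = (a - 1) / (a ^+ 2 * (a + 1)).
  by field; rewrite a0 a0'.
by rewrite divr_ge0 ?mulr_ge0 ?sqr_ge0 //; lra.
Qed.

Lemma sum_invsq_le2 (C : R) N : 0 <= C ->
  \sum_(0 <= n < N) C / n.+1%:R ^+ 2 <= C * 2.
Proof.
move=> C0; rewrite -mulr_sumr ler_wpM2l //; apply: le_trans (sum_invsq_le N) _.
by rewrite lerBlDr lerDl divr_ge0.
Qed.

Lemma cvg_iter_npow s k : `|Re s| + 3 <= k%:R ->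
  iter k Delta (npow s) @ \oo --> (0 : Cplx R).
Proof.
move=> /iter_npow_bound[C [C0 H]].
rewrite -(cvg_shiftS (iter k Delta (npow s))).
apply: (@cvg_cmod_squeeze _ _ (fun n => C * harmonic n)).
  move=> n /=; rewrite subr0; apply: le_trans (H _ (ltn0Sn n)) _.
  rewrite ler_wpM2l // lef_pV2 ?posrE ?exprn_gt0 ?ltr0n //.
  by rewrite expr2 ler_peMl // ler1n.
by rewrite -[0](mulr0 C); apply: cvgMl_tmp; exact: cvg_harmonic.
Qed.

(** One large k gives existence; by [cvg_euler_sumS] all admissible k share the limit. Hence a
    single function can be chosen, and near each point one fixed k describes it. *)
Lemma ex_euler_limit s : exists l : Cplx R, forall k : nat, `|Re s| + 3 <= k%:R ->
  euler_sum k (npow s) @ \oo --> l.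
Proof.
pose k0 := (Num.bound (`|Re s| + 3)).
have good0 : `|Re s| + 3 <= k0%:R.
  by apply/ltW/archi_boundP; rewrite addr_ge0.
have [T HT] : exists T : Cplx R,
    series (fun n => X n.+1 * iter k0 Delta (npow s) n.+1) @ \oo --> T.
  have [C [C0 H]] := iter_npow_bound good0.
  apply: (@cvg_series_abs _ _ (C * 2)) => N; apply: le_trans (sum_invsq_le2 N C0).
  by apply: ler_sum => n _; apply: le_trans (cmod_chiM _ _) (H _ _).
have H0 : euler_sum k0 (npow s) @ \oo --> euler_head k0 (npow s) + 2^-1 ^+ k0 * T.
  by apply: cvgD; [exact: cvg_cst | exact: cvgMl_tmp].
exists (euler_head k0 (npow s) + 2^-1 ^+ k0 * T); set l := _ + _ in H0 *.
have climb k d : `|Re s| + 3 <= k%:R ->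
    euler_sum k (npow s) @ \oo --> l <-> euler_sum (k + d) (npow s) @ \oo --> l.
  move=> gk; elim: d => [|d IH]; first by rewrite addn0.
  rewrite IH addnS; apply: cvg_euler_sumS; apply: cvg_iter_npow.
  by apply: le_trans gk _; rewrite ler_nat leq_addr.
move=> k gk; have [kk0|k0k] := leqP k k0.
  by apply/(climb k (k0 - k)%N gk); rewrite subnKC.
by have := (climb k0 (k - k0)%N good0).1 H0; rewrite subnKC // ltnW.
Qed.

Definition Lext : Cplx R -> Cplx R := projT1 (choice ex_euler_limit).

Lemma cvg_Lext s (k : nat) : `|Re s| + 3 <= k%:R ->
  euler_sum k (npow s) @ \oo --> Lext s.
Proof. exact: (projT2 (choice ex_euler_limit) s k). Qed.

Lemma cvg_npow s : 1 < Re s -> (npow s) @ \oo --> (0 : Cplx R).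
Proof.
move=> s1; rewrite -(cvg_shiftS (npow s)).
apply: (@cvg_cmod_squeeze _ _ harmonic _); last exact: cvg_harmonic.
move=> n /=; rewrite subr0 cmod_cexp cReM cReN /= mulr0 subr0.
have n1 : 0 < n.+1%:R :> R by rewrite ltr0n.
rewrite -{2}[n.+1%:R](lnK (_ : n.+1%:R \is Num.pos)) ?posrE //.
rewrite -expRN ler_expR mulNr lerN2 ler_peMl //; last exact: ltW.
by rewrite ln_ge0 // ler1n.
Qed.

Lemma cvg_iter_fdiff0 k (f : nat -> Cplx R) : f @ \oo --> (0 : Cplx R) ->
  iter k Delta f @ \oo --> (0 : Cplx R).
Proof.
move=> f0; elim: k => [//|k IH] /=.
have IH' := IH; rewrite -(cvg_shiftn 10) in IH'.
by have := cvgB IH IH'; rewrite subr0; apply.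
Qed.

(** For Re s > 1 all differences of n^(-s) tend to 0, so k can be lowered to 0, where the Euler sum
    is the plain partial sum. *)
Lemma Lext_series s : 1 < Re s ->
  (\sum_(1 <= n < N) (chi n)%:~R * npow_opp n s) @[N --> \oo] --> Lext s.
Proof.
move=> s1; pose k := Num.bound (`|Re s| + 3).
have gk : `|Re s| + 3 <= k%:R by apply/ltW/archi_boundP; rewrite addr_ge0.
have H : euler_sum 0 (npow s) @ \oo --> Lext s.
  have := cvg_Lext gk; elim: k {gk} => [//|k IH] H.
  have [_ G] := cvg_euler_sumS (Lext s) (cvg_iter_fdiff0 k (cvg_npow s1)).
  exact: IH (G H).
rewrite -cvg_shiftS /=.
have -> : (fun n => \sum_(1 <= n0 < n.+1) (chi n0)%:~R * npow_opp n0 s) =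
  euler_sum 0 (npow s) ; last exact: H.
apply/funext => N; rewrite /euler_sum expr0 mul1r /euler_head [Z in _ = Z + _]big1 ?add0r.
  by rewrite big_add1.
by move=> n _; rewrite big_geq // mulr0.
Qed.

Lemma npow_natN m n : (0 < n)%N -> npow_opp n (- m%:R) = n%:R ^+ m :> Cplx R.
Proof.
move=> n0; rewrite /npow_opp opprK.
have -> : m%:R * (ln n%:R)%:C = (m%:R * ln n%:R)%:C :> Cplx R.
  by rewrite rmorphM /= rmorph_nat.
have -> : n%:R ^+ m = (n%:R ^+ m)%:C :> Cplx R by rewrite rmorphXn /= rmorph_nat.
apply: cplxP; rewrite /cexp !(cReM, cImM) /= cos0 sin0 expRM_natl lnK ?posrE ?ltr0n //.
  by rewrite mulr1 mulr0 subr0.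
by rewrite mulr0 mul0r addr0.
Qed.

(** Differences only look forward, so agreement at positive n suffices; [npow_natN] identifies the
    powers only there. *)
Lemma iter_fdiff_pos k (f g : nat -> Cplx R) n : (forall n, (0 < n)%N -> f n = g n) ->
  (0 < n)%N -> iter k Delta f n = iter k Delta g n.
Proof.
move=> fg; elim: k n => [|k IH] n n0 /=; first exact: fg.
by rewrite /fdiff !IH // addn_gt0 n0.
Qed.

(** The k-th difference of n^m vanishes for k > m, so the transformed partial sums are constant and
    equal to the head. *)
Lemma Lext_negint m k : (m + 3 <= k)%N ->
  Lext (- m%:R) = euler_head k (fun n => n%:R ^+ m).
Proof.
move=> mk; have gk : `|Re (- m%:R : Cplx R)| + 3 <= k%:R.
  rewrite cReN normrN -(rmorph_nat (real_complex R)) /= normr_nat.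
  by rewrite -natrD ler_nat.
have E i n : (0 < n)%N -> iter i Delta (npow (- m%:R)) n =
    iter i Delta (fun n => n%:R ^+ m) n :> Cplx R.
  by apply: iter_fdiff_pos => j; exact: npow_natN.
have EH : euler_head k (npow (- m%:R)) = euler_head k (fun n => n%:R ^+ m).
  apply: eq_big_nat => n /andP[n0 _]; congr (_ * _); apply: eq_bigr => i _.
  by rewrite E.
have Z n : iter k Delta (fun n => n%:R ^+ m : Cplx R) n = 0.
  have H1 : deg_lt (fun _ : unit => addn^~ 10) 2 (fun n : nat => n%:R : Cplx R).
    by move=> j l x /=; rewrite !natrD; ring.
  apply: (deg_lt_iter_fdiff (deg_ltX m H1)); lia.
have := cvg_Lext gk.
have -> : euler_sum k (npow (- m%:R)) = cst (euler_head k (fun n => n%:R ^+ m)).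
  apply/funext => N; rewrite /euler_sum EH big1 ?mulr0 ?addr0 // => n _.
  by rewrite E // Z mulr0.
by move=> H; apply: (cvg_unique _ H (cvg_cst _)).
Qed.

Lemma cvg_npow_taylor s z n :
  series (fun i => npow_coef s i n * (z - s) ^+ i) @ \oo --> npow_opp n z.
Proof.
have -> : npow_opp n z = npow_opp n s * cexp (- (z - s) * (ln n%:R)%:C).
  by rewrite /npow_opp -cexpD; congr cexp; ring.
have -> : series (fun i => npow_coef s i n * (z - s) ^+ i) =
    (fun N => npow_opp n s * exp_sum N (- (z - s) * (ln n%:R)%:C)).
  apply/funext => N; rewrite /series /exp_sum mulr_sumr; apply: eq_bigr => i _.
  rewrite /npow_coef -!mulrA; congr (_ * _).
  rewrite rmorphM /= fmorphV /= rmorph_nat rmorphXn rmorphN.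
  have -> : - (z - s) * (ln n%:R)%:C = - (ln n%:R)%:C * (z - s) by ring.
  by rewrite exprMn mulrAC mulrA.
by apply: cvgMl_tmp; exact: cvg_exp_sum.
Qed.

Lemma cvg_iter_taylor (g : nat -> nat -> Cplx R) (f : nat -> Cplx R) h k n :
  (forall n, series (fun i => g i n * h ^+ i) @ \oo --> f n) ->
  series (fun i => iter k Delta (g i) n * h ^+ i) @ \oo --> iter k Delta f n.
Proof.
move=> gf; elim: k n => [|k IH] n /=; first exact: gf.
have -> : series (fun i => Delta (iter k Delta (g i)) n * h ^+ i) =
   (fun N => series (fun i => iter k Delta (g i) n * h ^+ i) N -
       series (fun i => iter k Delta (g i) (n + 10)%N * h ^+ i) N).
  apply/funext => N; rewrite /series /= -sumrB; apply: eq_bigr => i _.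
  by rewrite /fdiff mulrBl.
exact: cvgB (IH n) (IH (n + 10)%N).
Qed.

Lemma cvg_head_taylor (g : nat -> nat -> Cplx R) (f : nat -> Cplx R) h k :
  (forall n, series (fun i => g i n * h ^+ i) @ \oo --> f n) ->
  series (fun i => euler_head k (g i) * h ^+ i) @ \oo --> euler_head k f.
Proof.
move=> gf.
have -> : series (fun i => euler_head k (g i) * h ^+ i) = (fun N =>
  \sum_(1 <= n < 11) X n * \sum_(0 <= j < k) 2^-1 ^+ j.+1 *
     series (fun i => iter j Delta (g i) n * h ^+ i) N).
  apply/funext => N; rewrite /series /euler_head /=.
  under eq_bigr do rewrite mulr_suml.
  rewrite exchange_big; apply: eq_bigr => n _ /=.
  under eq_bigr do rewrite -mulrA mulr_suml.
  rewrite -mulr_sumr exchange_big; congr (_ * _); apply: eq_bigr => j _ /=.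
  by rewrite mulr_sumr; apply: eq_bigr => i _; rewrite mulrA.
apply: cvg_sum => n; apply: cvgMl_tmp; apply: cvg_sum => j; apply: cvgMl_tmp.
exact: cvg_iter_taylor.
Qed.

(** For fixed k, each differenced term is expanded in powers of z - s and the sums over n and over
    the Taylor index are exchanged; the head is a finite combination of expandable terms. *)
Lemma entire_Lext : entire Lext.
Proof.
move=> s; pose k := Num.bound (`|Re s| + 4).
(* The margin 4 instead of 3 makes the same k admissible for every z with |z - s| <= 1. *)
have gk : `|Re s| + 4 <= k%:R by apply/ltW/archi_boundP; rewrite addr_ge0.
have gk3 : `|Re s| + 3 <= k%:R by lra.
have [C [C0 HC]] := npow_coef_sum_bound gk3.
have exA i : exists A : Cplx R,
    series (fun n => X n.+1 * iter k Delta (npow_coef s i) n.+1) @ \oo --> A.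
  apply: (@cvg_series_abs _ _ (C * 2)) => N; apply: le_trans (sum_invsq_le2 N C0).
  apply: ler_sum => n _; apply: le_trans (cmod_chiM _ _) _.
  apply: le_trans (HC n.+1 i.+1 isT); rewrite big_nat_recr //= lerDr.
  by apply: sumr_ge0 => j _; exact: cmod_ge0.
have [A HA] := choice exA.
exists (fun i => euler_head k (npow_coef s i) + 2^-1 ^+ k * A i).
have ball1 : \forall z \near s, cmod (s - z) < 1.
  by have /cvg_cmodP := @cvg_id _ (nbhs s); apply.
near=> z.
have hz : cmod (z - s) <= 1.
  by rewrite -cmodN opprB; apply: ltW; near: z.
set h := z - s in hz *.
have gz : `|Re z| + 3 <= k%:R.
  have : `|Re h| <= 1 by apply: le_trans (normRe_le _) hz.
  have -> : Re z = Re s + Re h by rewrite -cReD /h addrC subrK.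
  by have := ler_normD (Re s) (Re h); lra.
have Hz := cvg_Lext gz.
have Tay := @cvg_npow_taylor s z.
pose d n := X n.+1 * iter k Delta (npow z) n.+1.
have dT : series d @ \oo --> 2 ^+ k * (Lext z - euler_head k (npow z)).
  have -> : series d = (fun N => 2 ^+ k * (euler_sum k (npow z) N - euler_head k (npow z))).
    apply/funext => N; rewrite /euler_sum addrAC subrr add0r mulrA -exprMn divff //.
    by rewrite expr1n mul1r.
  exact: cvgMl_tmp (cvgB Hz (cvg_cst (euler_head k (npow z)))).
have AT : series (fun i => A i * h ^+ i) @ \oo --> 2 ^+ k * (Lext z - euler_head k (npow z)).
  apply: (@cvg_double_series _ (fun j i => X j.+1 * iter k Delta (npow_coef s i) j.+1 * h ^+ i)
    (fun j => C / j.+1%:R ^+ 2) (C * 2) d).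
  - move=> j N; apply: le_trans (HC j.+1 N isT); apply: ler_sum => i _.
    rewrite cmodM cmodX; apply: le_trans (cmod_chiM j.+1 _).
    by rewrite ler_piMr ?cmod_ge0 // exprn_ile1 ?cmod_ge0.
  - by move=> J; exact: sum_invsq_le2.
  - move=> j.
    have -> : series (fun i => X j.+1 * iter k Delta (npow_coef s i) j.+1 * h ^+ i) =
      (fun N => X j.+1 * series (fun i => iter k Delta (npow_coef s i) j.+1 * h ^+ i) N).
      by apply/funext => N; rewrite /series /= mulr_sumr; apply: eq_bigr => i _; rewrite mulrA.
    have T1 := @cvg_iter_taylor _ _ h k j.+1 Tay.
    exact: cvgMl_tmp T1.
  - exact: dT.
  - move=> i.
    have -> : series (fun j => X j.+1 * iter k Delta (npow_coef s i) j.+1 * h ^+ i) =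
      (fun N => series (fun j => X j.+1 * iter k Delta (npow_coef s i) j.+1) N * h ^+ i).
      by apply/funext => N; rewrite /series /= mulr_suml.
    exact: cvgMr_tmp (HA i).
have -> : series (fun i => (euler_head k (npow_coef s i) + 2^-1 ^+ k * A i) * h ^+ i) =
  (fun N => series (fun i => euler_head k (npow_coef s i) * h ^+ i) N +
    2^-1 ^+ k * series (fun i => A i * h ^+ i) N).
  apply/funext => N; rewrite /series /= mulr_sumr -big_split; apply: eq_bigr => i _ /=.
  by rewrite mulrDl mulrA.
have -> : Lext z = euler_head k (npow z) +
    2^-1 ^+ k * (2 ^+ k * (Lext z - euler_head k (npow z))).
  by rewrite mulrA -exprMn mulVf // expr1n mul1r addrC subrK.
have T1 := @cvg_head_taylor _ _ h k Tay.
exact: cvgD T1 (cvgMl_tmp AT).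
Unshelve. all: by end_near. Qed.

Lemma continues_Lext : continues_Lseries chi Lext.
Proof. by split; [exact: entire_Lext | exact: Lext_series]. Qed.

End Continuation.

(** * Uniqueness of the continuation *)

Section Uniqueness.
Variable R : realType.
Local Notation Re := complex.Re.

Lemma cvg_cplx_unique (u : nat -> Cplx R) (l m : Cplx R) :
  u @ \oo --> l -> u @ \oo --> m -> l = m.
Proof. by move=> ul um; rewrite -(cvg_lim _ ul) // (cvg_lim _ um). Qed.

Lemma sum_geom_le2 (t : R) n : 0 <= t -> t <= 2^-1 -> \sum_(0 <= k < n) t ^+ k <= 2.
Proof.
move=> t0 t1; elim: n => [|n IH]; first by rewrite big_geq.
rewrite big_nat_recl // expr0.
have -> : \sum_(0 <= i < n) t ^+ i.+1 = t * \sum_(0 <= i < n) t ^+ i.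
  by rewrite mulr_sumr; apply: eq_bigr => i _; rewrite exprS.
have : 0 <= \sum_(0 <= i < n) t ^+ i by apply: sumr_ge0 => i _; rewrite exprn_ge0.
move: IH; move: (\sum_(0 <= i < n) _) => g; nra.
Qed.

(** Convergence at h0 bounds |a_k| h0^k by some B; at h = h0 t the vanishing of the sum then gives
    |a_0| <= 2 B t for t <= 1/2, and t is arbitrarily small. *)
Lemma series_zero_coef0 (a : nat -> Cplx R) (e : R) : 0 < e ->
  (forall h : R, 0 < h < e -> series (fun k => a k * h%:C ^+ k) @ \oo --> (0 : Cplx R)) ->
  a 0%N = 0.
Proof.
move=> e0 H; pose h0 := e / 2.
have h00 : 0 < h0 by rewrite divr_gt0.
have h0e : h0 < e by rewrite /h0; lra.
have /H Hh0 : 0 < h0 < e by rewrite h00.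
have [B [B0 HB]] : exists B : R, 0 <= B /\ forall k, cmod (a k) * h0 ^+ k <= B.
  have t0 : (fun k => a k * h0%:C ^+ k) @ \oo --> (0 : Cplx R).
    by apply: cvg_series_cvg_0; exact: cvgP Hh0.
  move/cvg_cmodP : t0 => /(_ 1 ltr01) [N0 _ HN].
  have E k : cmod (a k * h0%:C ^+ k) = cmod (a k) * h0 ^+ k.
    by rewrite cmodM cmodX cmod_real gtr0_norm.
  exists (1 + \sum_(0 <= k < N0) cmod (a k) * h0 ^+ k).
  have S0 (i : nat) : 0 <= cmod (a i) * h0 ^+ i.
    by rewrite mulr_ge0 ?cmod_ge0 // exprn_ge0 // ltW.
  split=> [|k]; first by rewrite addr_ge0 // sumr_ge0.
  have [kN|Nk] := ltnP k N0.
    rewrite (bigD1_seq k) ?mem_index_iota ?iota_uniq //= addrCA lerDl.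
    by rewrite addr_ge0 // sumr_ge0.
  have /ltW := HN k Nk; rewrite /= sub0r cmodN E => h.
  by apply: le_trans h _; rewrite lerDl sumr_ge0.
have bound (t : R) : 0 < t -> t <= 2^-1 -> cmod (a 0%N) <= 2 * B * t.
  move=> t0 t1.
  have /H Ht : 0 < h0 * t < e by rewrite mulr_gt0 //=; apply: lt_trans h0e; nra.
  rewrite -cmodN -sub0r; apply: (cmod_lim_le Ht); near=> N.
  have N1 : (0 < N)%N by near: N; exact: nbhs_infty_gt.
  rewrite -(prednK N1) /series /= big_nat_recl // expr0 mulr1 addrAC subrr add0r.
  apply: le_trans (cmod_sum _ _ _) _.
  apply: (@le_trans _ _ (\sum_(0 <= i < N.-1) B * t * t ^+ i)).
    apply: ler_sum => i _; rewrite cmodM cmodX cmod_real gtr0_norm ?mulr_gt0 //.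
    rewrite exprMn mulrA -[B * t * _]mulrA -exprS ler_wpM2r ?exprn_ge0 ?(ltW t0) //.
  rewrite -mulr_sumr mulrC -mulrA ler_wpM2r ?mulr_ge0 ?(ltW t0) //.
  by apply: sum_geom_le2 => //; exact: ltW.
have c0 : cmod (a 0%N) <= 0.
  apply/ler_addgt0Pl => r r0; rewrite addr0.
  (* This makes 2 B t <= r; the added 1 keeps the denominator positive when B = 0. *)
  pose t := Num.min 2^-1 (r / (2 * B + 1)).
  have D0 : 0 < 2 * B + 1 by lra.
  have t0 : 0 < t by rewrite lt_min invr_gt0 ltr0n /= divr_gt0.
  apply: le_trans (bound t t0 _) _; first by rewrite ge_min lexx.
  have : t <= r / (2 * B + 1) by rewrite ge_min lexx orbT.
  rewrite ler_pdivlMr //; nra.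
apply/eqP; rewrite -normr_eq0 cmodE.
have -> : cmod (a 0%N) = 0 by apply/eqP; rewrite eq_le c0 cmod_ge0.
by [].
Unshelve. all: by end_near. Qed.

Lemma series_zero_coef (a : nat -> Cplx R) (e : R) k : 0 < e ->
  (forall h : R, 0 < h < e -> series (fun k => a k * h%:C ^+ k) @ \oo --> (0 : Cplx R)) ->
  a k = 0.
Proof.
move=> e0; elim: k a => [|k IH] a H; first exact: series_zero_coef0 H.
apply: (IH (fun k => a k.+1)) => h he; have a0 := series_zero_coef0 e0 H.
have h0 : h%:C != 0 :> Cplx R.
  by rewrite -(rmorph0 (real_complex R)) (inj_eq (@complexI R)) gt_eqF //; case/andP: he.
have := H h he; rewrite -cvg_shiftS => Hh.
have := cvgMl_tmp (a := (h%:C)^-1) Hh; rewrite mulr0.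
have -> : (fun n => (h%:C)^-1 * series (fun k => a k * h%:C ^+ k) n.+1) =
    series (fun k => a k.+1 * h%:C ^+ k).
  apply/funext => n; rewrite /series /= big_nat_recl // a0 mul0r add0r mulr_sumr.
  by apply: eq_bigr => i _; rewrite exprS mulrCA mulKf.
by apply.
Qed.

Lemma cvg_real_complex_nbhs (x : R) : (fun y : R => y%:C : Cplx R) @ x --> (x%:C : Cplx R).
Proof.
apply/cvg_cmodP => e e0.
have /cvgrPdist_lt/(_ e e0) : id @ x --> x by exact: cvg_id.
apply: filterS => y; rewrite -rmorphB /= cmod_real //.
Qed.

(** If f were nonzero at some real x1, the set of points beyond which f vanishes would have an
    infimum; the expansion there is zero, so f vanishes slightly to the left as well, a
    contradiction. *)
Lemma entire_real_zero (f : Cplx R -> Cplx R) : entire f ->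
  (forall x : R, 1 < x -> f x%:C = 0) -> forall x : R, f x%:C = 0.
Proof.
move=> ef f1.
(* Vanishing just to the right of x kills all coefficients of the expansion at x, hence f on both
   sides. *)
have loc (x : R) : exists2 e : R, 0 < e &
    (forall y, x < y < x + e -> f y%:C = 0) -> (forall y, `|x - y| < e -> f y%:C = 0).
  have [a Ha] := ef x%:C.
  have : \forall y \near x, series (fun k => a k * (y%:C - x%:C) ^+ k) @ \oo --> f y%:C.
    exact: (cvg_real_complex_nbhs Ha).
  move=> /nbhs_ballP[e /= e0 He]; exists e => // Hz.
  have a0 k : a k = 0.
    apply: (@series_zero_coef a e k e0) => h /andP[h0 he].
    have := He (x + h); rewrite /ball /= opprD addNKr normrN gtr0_norm // => /(_ he).
    by rewrite rmorphD /= addrAC subrr add0r -rmorphD Hz // ltrDl h0 ltrD2l.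
  move=> y /He /=.
  have -> : series (fun k => a k * (y%:C - x%:C) ^+ k) = cst (0 : Cplx R).
    by apply/funext => n; rewrite /series /= big1 // => k _; rewrite a0 mul0r.
  move=> Hy; have C0 : cst (0 : Cplx R) @ \oo --> (0 : Cplx R) by exact: cvg_cst.
  exact: (cvg_cplx_unique Hy C0).
move=> x1; apply/eqP; apply: contraT => fx1.
pose S := [set x : R | forall y, x <= y -> f y%:C = 0].
have S2 : S 2 by move=> y y2; apply: f1; lra.
have lbS : lbound S x1.
  move=> s Ss; rewrite leNgt; apply/negP => sx; move/negP: fx1; apply.
  by apply/eqP/Ss/ltW.
have infS : has_inf S by split; [exists 2 | exists x1].
have Hm y : inf S < y -> f y%:C = 0.
  by move=> /(inf_lt infS.1)[s Ss sy]; apply: Ss; exact: ltW.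
have [e e0 He] := loc (inf S).
have : S (inf S - e / 2).
  move=> y ye; have [my|ym] := ltP (inf S) y; first exact: Hm.
  apply: He => [z /andP[mz _]|]; first exact: Hm.
  by rewrite ger0_norm ?subr_ge0 //; lra.
move=> /(ge_inf infS.2); lra.
Qed.

Lemma entireB (f g : Cplx R -> Cplx R) : entire f -> entire g ->
  entire (fun z => f z - g z).
Proof.
move=> ef eg s; have [a Ha] := ef s; have [b Hb] := eg s.
exists (fun k => a k - b k).
apply: filterS (filterI Ha Hb) => z [Az Bz].
have -> : series (fun k => (a k - b k) * (z - s) ^+ k) =
    (fun n => series (fun k => a k * (z - s) ^+ k) n - series (fun k => b k * (z - s) ^+ k) n).
  by apply/funext => n; rewrite /series /= -sumrB; apply: eq_bigr => k _; rewrite mulrBl.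
exact: cvgB Az Bz.
Qed.

Lemma continues_Lseries_real (chi : nat -> int) (L1 L2 : Cplx R -> Cplx R) (x : R) :
  continues_Lseries chi L1 -> continues_Lseries chi L2 -> L1 x%:C = L2 x%:C.
Proof.
move=> [e1 H1] [e2 H2]; apply/eqP; rewrite -subr_eq0; apply/eqP.
apply: (@entire_real_zero (fun z => L1 z - L2 z)); first exact: entireB.
move=> {}x x1; have C1 := H1 x%:C x1; have C2 := H2 x%:C x1.
by rewrite (cvg_cplx_unique C1 C2) subrr.
Qed.

(** [Lext] is a continuation, so [xget] does not return its default and [Lfun] is a continuation
    too; the two agree at the real point -m. *)
Lemma Lfun_negint (chi : nat -> int) m k :
  (forall n, chi (n + 10)%N = - chi n) -> (forall n, `|chi n| <= 1) ->
  (m + 3 <= k)%N ->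
  Defs.Lfun chi (- m%:R : Cplx R) = euler_head chi k (fun n => n%:R ^+ m).
Proof.
move=> ca c1 mk; rewrite -(Lext_negint R ca c1 mk).
have HL := continues_Lext R ca c1.
have HF : continues_Lseries chi (@Defs.Lfun R chi).
  by apply: xgetPex; exists (@Lext R chi ca c1).
have -> : - m%:R = (- m%:R)%:C :> Cplx R by rewrite rmorphN /= rmorph_nat.
exact: continues_Lseries_real HF HL.
Qed.

End Uniqueness.

(** * Comparison of the coefficients *)

Section Assembly.
Variable R : realType.
Local Notation Delta := (fdiff (addn^~ 10)).

Lemma iter_fdiff_sum (K : pzRingType) (T : Type) (tau : T -> T) k (r : seq nat)
    (c : nat -> K) (g : nat -> T -> K) x :
  iter k (fdiff tau) (fun y => \sum_(i <- r) c i * g i y) x =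
  \sum_(i <- r) c i * iter k (fdiff tau) (g i) x.
Proof.
elim: k x => [//|k IH] x /=; rewrite /fdiff !IH -sumrB.
by apply: eq_bigr => i _; rewrite mulrBr.
Qed.

Lemma abel_euler_sum (K : numFieldType) k a b (r : seq nat) (c : nat -> K) (g : nat -> nat -> K) :
  abel_euler k a b (fun y => \sum_(i <- r) c i * g i y) =
  \sum_(i <- r) c i * abel_euler k a b (g i).
Proof.
rewrite /abel_euler.
under [RHS]eq_bigr do rewrite mulr_sumr.
rewrite [RHS]exchange_big; apply: eq_bigr => j _ /=.
rewrite !iter_fdiff_sum -sumrB mulr_sumr; apply: eq_bigr => i _.
by rewrite -mulrBr mulrCA.
Qed.

Lemma eq_abel_euler (K : numFieldType) k a b (f g : nat -> K) : f =1 g ->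
  abel_euler k a b f = abel_euler k a b g.
Proof.
by move=> fg; apply: eq_bigr => i _; rewrite !(eq_iter_fdiff _ _ fg).
Qed.

Lemma abel_eulerZ (K : numFieldType) k a b c (f : nat -> K) :
  abel_euler k a b (fun n => c * f n) = c * abel_euler k a b f.
Proof.
rewrite /abel_euler mulr_sumr; apply: eq_bigr => i _.
by rewrite !iter_fdiffZ -mulrBr mulrCA.
Qed.

(** Binomial theorem: expanding ((n^2 - r^2)/40)^N inside [moment] gives the Cauchy product with
    e^(r^2 t/40), since [abel_euler] is linear. A common k for all n <= N is what permits this. *)
Lemma fps_mul_abel_euler (K : numFieldType) (T : nat -> K) r k a b N :
  (forall n, (n <= N)%N -> T n = 2^-1 * (-1) ^+ n.+1 *
     abel_euler k a b (fun j => j%:R ^+ (2 * n).+1)) ->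
  fps_mul (fps_exp (r%:R ^+ 2 / 40)) (fun n => T n / n`!%:R * (1 / 40) ^+ n) N =
  - ((-1) ^+ N / N`!%:R) * abel_euler k a b (@moment K r N).
Proof.
move=> HT; rewrite -abel_eulerZ.
pose c i : K := (r%:R ^+ 2 / 40) ^+ i / i`!%:R *
  (2^-1 * (-1) ^+ (N - i).+1 / (N - i)`!%:R * (1 / 40) ^+ (N - i)).
transitivity (\sum_(0 <= i < N.+1) c i * abel_euler k a b (fun j => j%:R ^+ (2 * (N - i)).+1)).
  rewrite big_mkord /fps_mul; apply: eq_bigr => i _.
  by rewrite /fps_exp HT ?leq_subr // /c; ring.
rewrite -abel_euler_sum; apply: eq_abel_euler => n; rewrite /moment.
rewrite /c; move: (n%:R : K) (r%:R ^+ 2 : K) => x y.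
have -> : - ((-1) ^+ N / N`!%:R) * (x / 2 * ((x ^+ 2 - y) / 40) ^+ N) =
   - (x / 2) / N`!%:R * (- (x ^+ 2 / 40) + y / 40) ^+ N.
  transitivity (- (x / 2) / N`!%:R * (- ((x ^+ 2 - y) / 40)) ^+ N).
    by rewrite [in RHS]exprNn; ring.
  by congr (_ * _ ^+ _); field.
rewrite exprDn mulr_sumr big_mkord; apply: eq_bigr => i _.
have iN : (i <= N)%N by rewrite -ltnS.
rewrite -(bin_fact iN) -[_ *+ 'C(N, i)]mulr_natr !natrM.
have H m : m`!%:R != 0 :> K by rewrite pnatr_eq0 -lt0n fact_gt0.
have H1 : 'C(N, i)%:R != 0 :> K by rewrite pnatr_eq0 -lt0n bin_gt0.
rewrite [(- (_ / 40)) ^+ _]exprNn [(x ^+ 2 / 40) ^+ _]expr_div_n -exprM.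
rewrite [(1 / 40) ^+ _]expr_div_n expr1n.
rewrite [(y / 40) ^+ _]expr_div_n !exprS.
have H40 j : 40 ^+ j != 0 :> K by rewrite expf_neq0 // pnatr_eq0.
field; rewrite !H H1 ?H40 //.
Qed.

Lemma chi20_0_anti n : chi20_0 (n + 10) = - chi20_0 n.
Proof.
rewrite /chi20_0 -modnDml; have : (n %% 20 < 20)%N by rewrite ltn_mod.
by move: (n %% 20)%N; do 20 case=> //.
Qed.

Lemma chi20_1_anti n : chi20_1 (n + 10) = - chi20_1 n.
Proof.
rewrite /chi20_1 -modnDml; have : (n %% 20 < 20)%N by rewrite ltn_mod.
by move: (n %% 20)%N; do 20 case=> //.
Qed.

Lemma chi20_0_le1 n : `|chi20_0 n| <= 1.
Proof. by rewrite /chi20_0; do 2 case: ifP => _ //. Qed.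

Lemma chi20_1_le1 n : `|chi20_1 n| <= 1.
Proof. by rewrite /chi20_1; do 2 case: ifP => _ //. Qed.

(** On the half-period chi is 1 at a, -1 at b and 0 elsewhere, so two terms of the head survive. *)
Lemma euler_head_abel chi a b k (f : nat -> Cplx R) :
  (forall n, (0 < n < 11)%N -> chi n = (n == a)%:R - (n == b)%:R) ->
  (0 < a < 11)%N -> (0 < b < 11)%N ->
  euler_head chi k f = abel_euler k a b f.
Proof.
move=> Hchi Ha Hb; rewrite /euler_head.
pose E n : Cplx R := \sum_(0 <= i < k) 2^-1 ^+ i.+1 * iter i Delta f n.
have pick c : (0 < c < 11)%N -> \sum_(1 <= n < 11) (n == c)%:R * E n = E c.
  move=> Hc; rewrite (bigD1_seq c) ?mem_index_iota ?iota_uniq //= eqxx mul1r.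
  by rewrite big1 ?addr0 // => n /negPf ->; rewrite mul0r.
transitivity (E a - E b).
  rewrite -(pick a Ha) -(pick b Hb) -sumrB; apply: eq_big_nat => n Hn.
  by rewrite Hchi // rmorphB /= !rmorph_nat mulrBl.
rewrite /E -sumrB big_mkord; apply: eq_bigr => i _.
by rewrite mulrBr.
Qed.

Lemma T2E chi a b k n :
  (forall n, chi (n + 10)%N = - chi n) -> (forall n, `|chi n| <= 1) ->
  (forall n, (0 < n < 11)%N -> chi n = (n == a)%:R - (n == b)%:R) ->
  (0 < a < 11)%N -> (0 < b < 11)%N -> (2 * n + 4 <= k)%N ->
  T2 R chi n = 2^-1 * (-1) ^+ n.+1 * abel_euler k a b (fun j => j%:R ^+ (2 * n).+1).
Proof.
move=> ca c1 cE Ha Hb nk; rewrite /T2 div1r; congr (_ * _).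
have -> : - 2 * n%:R - 1 = - (2 * n).+1%:R :> Cplx R.
  by rewrite -[(2 * n).+1]addn1 natrD natrM; ring.
rewrite (Lfun_negint _ ca c1 (k := k)); last by lia.
exact: euler_head_abel cE Ha Hb.
Qed.

End Assembly.

Theorem theorem1p1 (R : realType) :
  fps_sum 0 (fun n => subst_exp (X20_term (Cplx R) n))
    (fps_mul (fps_exp (9 / 40))
       (fun n => T2 R chi20_0 n / n`!%:R * (1 / 40) ^+ n))
  /\
  fps_sum 1 (fun n => subst_exp (X21_term (Cplx R) n))
    (fps_mul (fps_exp (1 / 40))
       (fun n => T2 R chi20_1 n / n`!%:R * (1 / 40) ^+ n)).
Proof.
split=> N.
  (* The order 2N + 4 serves all n <= N at once: [T2E] asks for 2n + 4, [sum_X20] for 2N + 2. *)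
  exists (N + 2)%N => m Nm; have Nk : (2 * N + 2 <= 2 * N + 4)%N by lia.
  rewrite (sum_X20 _ Nm Nk).
  have -> : 9 / 40 = 3%:R ^+ 2 / 40 :> Cplx R by rewrite -natrX.
  apply/esym/fps_mul_abel_euler => n nN.
  apply: T2E; [exact: chi20_0_anti | exact: chi20_0_le1 | | by [] | by [] | by lia].
  by move=> j; do 11 case: j => [//|j].
(* One more than before: the series starts at n = 1, so the exclusive upper bound m+1 corresponds to
   m summands. *)
exists (N + 3)%N => -[|m] Nm; first by lia.
have Nk : (2 * N + 2 <= 2 * N + 4)%N by lia.
have Nm' : (N + 2 <= m)%N by lia.
rewrite (sum_X21 _ Nm' Nk).
have -> : fps_exp (1 / 40) = fps_exp (1%:R ^+ 2 / 40) :> fps (Cplx R) by rewrite expr1n.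
apply/esym/fps_mul_abel_euler => n nN.
apply: T2E; [exact: chi20_1_anti | exact: chi20_1_le1 | | by [] | by [] | by lia].
by move=> j; do 11 case: j => [//|j].
Qed.
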